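(* For every integer $t$ with $t \geq 2$, for every graph $X$ with $\operatorname{rtd}_2(X) \leq t$, there exists an integer $c$ such that for every graph $G$, if $G$ is $X$-minor-free, then for every integer $r$ with $r \geq 2$, \[ \operatorname{wcol}_r(G) \leq c \cdot (\operatorname{tw}(G)+1) \cdot r^{t-2} \log r. \]
   Context: For a graph $G$, an ordering $\sigma$ of $V(G)$, a nonnegative integer $r$ and a vertex $u$, a vertex $v$ is weakly $r$-reachable from $u$ in $(G,\sigma)$ if there is a $u$–$v$ path in $G$ with at most $r$ edges all of whose vertices $w$ satisfy $v \leq_\sigma w$; $\operatorname{WReach}_r[G,\sigma,u]$ denotes the set of such $v$, and $\operatorname{wcol}_r(G)=\min_{\sigma}\max_{u\in V(G)}|\operatorname{WReach}_r[G,\sigma,u]|$. $\operatorname{tw}$ is treewidth. A separation of order $k$ of $G$ is a pair $(A,B)$ of subgraphs with $A\cup B=G$, $E(A\cap B)=\emptyset$, $|V(A\cap B)|=k$. The rooted $2$-treedepth $\operatorname{rtd}_2(G)$ is $0$ for the null graph, $1$ for a one-vertex graph, and otherwise the minimum of $\max\{\operatorname{rtd}_2(A),\operatorname{rtd}_2(B\setminus V(A))+|V(A)\cap V(B)|\}$ over all separations $(A,B)$ of $G$ of order at most one with $V(A)\neq\emptyset$ and $V(B)\setminus V(A)\neq\emptyset$. *)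

(* Defs.v *)
From mathcomp Require Import all_boot all_order all_algebra.
From mathcomp Require Import boolp reals exp.

Set Implicit Arguments.
Unset Strict Implicit.
Unset Printing Implicit Defensive.

Import Order.TTheory GRing.Theory Num.Theory.

Local Open Scope nat_scope.

(* Least element of a set of naturals; 0 if the set is empty. *)
Definition minimum (P : nat -> Prop) : nat :=
  if pselect (exists n, `[< P n >]) is left exP then ex_minn exP else 0.

Lemma minimumP (P : nat -> Prop) : (exists n, P n) ->
  P (minimum P) /\ (forall n, P n -> minimum P <= n).
Proof.
move=> [n Pn]; rewrite /minimum; case: pselect => [exP|]; last first.
  by case; exists n; apply/asboolP.
case: ex_minnP => m /asboolP Pm min_m; split=> // k Pk.
by apply: min_m; apply/asboolP.
Qed.

Lemma eq_minimum (P Q : nat -> Prop) :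
  (forall n, P n <-> Q n) -> minimum P = minimum Q.
Proof. by move=> PQ; congr minimum; apply/funext => n; apply/propext. Qed.

(* Finite simple graphs; the vertex set may be empty. *)
Record sgraph := SGraph {
  svertex :> finType;
  sedge : rel svertex;
  sedge_sym : symmetric sedge;
  sedge_irr : irreflexive sedge }.

Section Graph.
Variable G : sgraph.

Definition connected_in (B : {set G}) : Prop :=
  forall x y, x \in B -> y \in B ->
    connect [rel u v | [&& u \in B, v \in B & sedge u v]] x y.

Definition is_tree : Prop :=
  [/\ 0 < #|G|, connected_in [set: G]
    & forall c : seq G, 2 < size c -> ~ ucycle (@sedge G) c].

(* Minors are given by models: disjoint, nonempty, connected branch sets. *)
Definition is_model (X : sgraph) (B : X -> {set G}) : Prop :=
  [/\ forall x, B x != set0,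
      forall x, connected_in (B x),
      forall x y, x != y -> [disjoint B x & B y]
    & forall x y, sedge x y ->
        exists u v, [/\ u \in B x, v \in B y & sedge u v]].

Definition minor_free (X : sgraph) : Prop :=
  ~ exists B : X -> {set G}, is_model B.

End Graph.

Definition is_tree_decomposition (G T : sgraph) (W : T -> {set G}) : Prop :=
  [/\ is_tree T,
      forall u, exists x, u \in W x,
      forall u v, sedge u v -> exists x, (u \in W x) && (v \in W x)
    & forall u, connected_in [set x | u \in W x]].

(* Integer-valued: the null graph has treewidth -1. *)
Definition treewidth (G : sgraph) : int :=
  ((minimum (fun k => exists (T : sgraph) (W : T -> {set G}),
     is_tree_decomposition W /\ k = \max_(x : T) #|W x|))%:Z - 1)%R.

(* An ordering is given by its non-strict order relation. *)
Definition is_ordering (G : sgraph) (sigma : rel G) : Prop :=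
  [/\ total sigma, antisymmetric sigma & transitive sigma].

Definition weakly_reachable (G : sgraph) (sigma : rel G) (r : nat) (u v : G) :=
  exists p : seq G,
    [/\ path (@sedge G) u p, last u p = v, uniq (u :: p),
        size p <= r & forall w, w \in u :: p -> sigma v w].

Definition WReach (G : sgraph) (sigma : rel G) (r : nat) (u : G) : {set G} :=
  [set v | `[< weakly_reachable sigma r u v >]].

Definition wcol (r : nat) (G : sgraph) : nat :=
  minimum (fun k => exists sigma : rel G,
    is_ordering sigma /\ k = \max_(u : G) #|WReach sigma r u|).

Record subgraph (G : sgraph) := Subgraph {
  subV : {set G};
  subE : rel G;
  subE_sym : symmetric subE;
  subE_sub : forall x y, subE x y -> [&& x \in subV, y \in subV & sedge x y] }.

Section SubgraphOperations.
Variables (G : sgraph) (H : subgraph G).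

Definition sub_edge : rel {x : G | x \in subV H} :=
  [rel x y | subE H (val x) (val y)].

Fact sub_edge_sym : symmetric sub_edge.
Proof. by move=> x y; apply: subE_sym. Qed.

Fact sub_edge_irr : irreflexive sub_edge.
Proof.
move=> x; apply/negP => /(subE_sub)/and3P[_ _].
by rewrite sedge_irr.
Qed.

Definition graph_of : sgraph := SGraph sub_edge_sym sub_edge_irr.

Variable S : {set G}.

Definition del_edge : rel G :=
  [rel x y | [&& subE H x y, x \notin S & y \notin S]].

Fact del_edge_sym : symmetric del_edge.
Proof. by move=> x y; rewrite /del_edge /= subE_sym [X in _ && X]andbC. Qed.

Fact del_edge_sub x y :
  del_edge x y -> [&& x \in subV H :\: S, y \in subV H :\: S & sedge x y].
Proof.
case/and3P=> /(subE_sub)/and3P[Hx Hy xy] xS yS.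
by rewrite !inE Hx Hy xS yS.
Qed.

Definition subgraph_del : subgraph G := Subgraph del_edge_sym del_edge_sub.
End SubgraphOperations.

Definition is_separation (G : sgraph) (A B : subgraph G) : Prop :=
  [/\ subV A :|: subV B = [set: G],
      forall x y, sedge x y = subE A x y || subE B x y
    & forall x y, ~~ (subE A x y && subE B x y)].

Definition separation_order (G : sgraph) (A B : subgraph G) : nat :=
  #|subV A :&: subV B|.

(* [f] stands for the parameter on smaller graphs. *)
Definition rtd2_step (f : sgraph -> nat) (G : sgraph) : nat :=
  if #|G| <= 1 then #|G| else
  minimum (fun k => exists A B : subgraph G,
    [/\ is_separation A B, separation_order A B <= 1,
        subV A != set0, subV B :\: subV A != set0
      & k = maxn (f (graph_of A))
                 (f (graph_of (subgraph_del B (subV A)))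
                  + #|subV A :&: subV B|)]).

(* [n] is fuel; both graphs in the recursive step have fewer vertices than [G],
   so #|G| units suffice, see [rtd2E]. *)
Fixpoint rtd2_rec (n : nat) (G : sgraph) : nat :=
  if n is n'.+1 then rtd2_step (rtd2_rec n') G else 0.

Definition rtd2 (G : sgraph) : nat := rtd2_rec #|G| G.

Lemma card_graph_of (G : sgraph) (H : subgraph G) : #|graph_of H| = #|subV H|.
Proof. by rewrite card_sig; apply: eq_card => x; rewrite inE. Qed.

Lemma eq_rtd2_step (f g : sgraph -> nat) (G : sgraph) :
  (forall H : sgraph, #|H| < #|G| -> f H = g H) ->
  rtd2_step f G = rtd2_step g G.
Proof.
move=> fg; rewrite /rtd2_step; case: ifP => // _; apply: eq_minimum => k.
suff E (A B : subgraph G) :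
    is_separation A B -> subV A != set0 -> subV B :\: subV A != set0 ->
    f (graph_of A) = g (graph_of A) /\
    f (graph_of (subgraph_del B (subV A))) =
    g (graph_of (subgraph_del B (subV A))).
  split=> -[A [B [sAB oAB A0 B0 ->]]]; exists A, B; split=> //;
    by have [-> ->] := E _ _ sAB A0 B0.
move=> _ A0 B0; split; apply: fg; rewrite card_graph_of -cardsT;
  apply: proper_card; rewrite properT.
  by apply: contra_neq B0 => ->; rewrite setDT.
by apply: contra_neq A0 => /= e; apply/setP => x;
  have := in_setT x; rewrite -e !inE => /andP[/negbTE].
Qed.

Lemma rtd2_recE n (G : sgraph) : #|G| <= n -> rtd2_rec n G = rtd2 G.
Proof.
rewrite /rtd2; elim/ltn_ind: n G => -[|n] IHn G.
  by rewrite leqn0 => /eqP->.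
case: (posnP #|G|) => [G0 _|]; first by rewrite G0 /= /rtd2_step G0.
case EG: #|G| => [//|m] _; rewrite ltnS => mn /=.
apply: eq_rtd2_step => H; rewrite EG ltnS => Hm.
by rewrite (IHn n) ?(leq_trans Hm) // (IHn m).
Qed.

Lemma rtd2E (G : sgraph) : rtd2 G = rtd2_step rtd2 G.
Proof.
rewrite {1}/rtd2; case EG: #|G| => [|n] /=; first by rewrite /rtd2_step EG.
by apply: eq_rtd2_step => H; rewrite EG ltnS; apply: rtd2_recE.
Qed.

(* The minima above are taken over nonempty sets. *)
Lemma ordering_exists (G : sgraph) : exists sigma : rel G, is_ordering sigma.
Proof.
exists [rel x y | enum_rank x <= enum_rank y]; split=> [x y|x y|y x z] /=.
- exact: leq_total.
- by move=> /anti_leq/val_inj/enum_rank_inj.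
- exact: leq_trans.
Qed.

Lemma tree_decomposition_exists (G : sgraph) :
  exists (T : sgraph) (W : T -> {set G}), is_tree_decomposition W.
Proof.
have sy : symmetric (fun _ _ : unit => false) by [].
have ir : irreflexive (fun _ _ : unit => false) by [].
exists (SGraph sy ir), (fun=> [set: G]); split.
- split; first by rewrite card_unit.
    by move=> [] [] _ _; apply: connect0.
  by move=> [//|[] [//|[] c]] _; rewrite /ucycle /=.
- by move=> u; exists tt; rewrite inE.
- by move=> u v _; exists tt; rewrite !inE.
- by move=> u [] [] _ _; apply: connect0.
Qed.

Lemma separation_exists (G : sgraph) : 1 < #|G| ->
  exists A B : subgraph G,
    [/\ is_separation A B, separation_order A B <= 1,
        subV A != set0 & subV B :\: subV A != set0].
Proof.
rewrite -cardsT => /card_gt1P[v [w [_ _ vw]]].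
have sA : symmetric (fun _ _ : G => false) by [].
have iA (x y : G) : false -> [&& x \in [set v], y \in [set v] & sedge x y] by [].
have iB (x y : G) : sedge x y -> [&& x \in [set: G], y \in [set: G] & sedge x y].
  by rewrite !inE.
exists (Subgraph sA iA), (Subgraph (@sedge_sym G) iB); split=> /=.
- by split=> //=; rewrite setUT.
- by rewrite /separation_order /= setIT cards1.
- by apply/set0Pn; exists v; rewrite inE.
- by apply/set0Pn; exists w; rewrite !inE eq_sym vw.
Qed.

(* Main.v *)
Require Import Defs.
From mathcomp Require Import all_boot all_order all_algebra.
From mathcomp Require Import boolp reals exp.
From mathcomp Require Import zify.

(* Let [Psi] be an upward closed property of vertex sets. We show that a
   connected part of [G] without a model of [X] whose branch sets all satisfy
   [Psi] contains a set [S], with a ranking of [S] for which every vertex weakly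
   reaches few vertices of [S], such that no component [K] outside [S] satisfies
   [Psi] and the neighbourhood of [K] is covered by two connected sets avoiding
   [K]. Such sets can be refined inside the components that they leave, at the
   sum of the costs; with [Psi] "nonempty" the set [S] is everything.

   By definition of rooted 2-treedepth, [X] is built by repeatedly picking a
   vertex [a] and joining it completely to a new graph [Y] of smaller parameter.
   Taking for [Psi] "contains a model of an apex over many copies of [Y]" removes
   one such step, and leaves the case of an apex over [Y]. That case is handled
   by a sequence of layers. If a connected set [e] is adjacent to a part [C],
   then no model of [Y] (plus a vertex) in [C] has all its branch sets touching
   [e]; so induction separates [e] from whatever still satisfies [Psi] in [C].
   A path of length [r] meets at most [r.+1] nested layers, which costs a factor
   [r]. If [Y] is edgeless, the layers have bounded size and they are linearly
   arranged, so ranking them by divisibility by powers of two costs only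
   [log r].

   Treewidth enters through one lemma on tree decompositions: for a property of
   connected sets there is a minimal connected [H] with connected complement
   whose frontier, and a set breaking the property inside [H], lie in one bag. *)

Set Implicit Arguments.
Unset Strict Implicit.
Unset Printing Implicit Defensive.

Import Order.TTheory GRing.Theory Num.Theory.

Local Open Scope nat_scope.

(** * Connected sets and components *)

Section Connectivity.
Variable G : sgraph.
Implicit Types (A B C D K M : {set G}) (u v x y z : G).

Definition inrel A : rel G := [rel u v | [&& u \in A, v \in A & sedge u v]].

Lemma inrelE A u v : inrel A u v = [&& u \in A, v \in A & sedge u v].
Proof. by []. Qed.

Definition component A x : {set G} := [set y | connect (inrel A) x y].

Definition adj A B : Prop := exists x y, [/\ x \in A, y \in B & sedge x y].

Lemma adjC A B : adj A B -> adj B A.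
Proof. by case=> x [y [xA yB xy]]; exists y, x; split=> //; rewrite sedge_sym. Qed.

Lemma adjS A A' B B' : A \subset A' -> B \subset B' -> adj A B -> adj A' B'.
Proof.
by move=> /subsetP AA /subsetP BB [x [y [xA yB xy]]]; exists x, y;
  split=> //; [apply: AA|apply: BB].
Qed.

Lemma connectC A x y : connect (inrel A) x y = connect (inrel A) y x.
Proof.
apply: sym_connect_sym => u v; rewrite !inrelE sedge_sym.
by case: (u \in A); case: (v \in A).
Qed.

Lemma connectS A B x y : A \subset B ->
  connect (inrel A) x y -> connect (inrel B) x y.
Proof.
move=> /subsetP AB; apply: connect_sub => u v /and3P[uA vA uv].
by apply: connect1; rewrite inrelE !AB.
Qed.

Lemma connected_ind B (P : G -> Prop) x : connected_in B -> x \in B -> P x ->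
  (forall u v, u \in B -> v \in B -> P u -> sedge u v -> P v) ->
  forall y, y \in B -> P y.
Proof.
move=> cB xB Px IH y yB; have /connectP[p] := cB x y xB yB.
elim: p x xB Px => [|z p IHp] x xB Px /=; first by move=> _ ->.
by case/andP=> /and3P[_ zB xz] /IHp; apply=> //; apply: IH Px xz.
Qed.

Lemma connected_from B x :
  (forall y, y \in B -> connect (inrel B) x y) -> connected_in B.
Proof.
move=> cB y z yB zB; apply: connect_trans (cB z zB).
by rewrite connectC; apply: cB.
Qed.

Lemma connected_cover D B x : connected_in D -> x \in D -> D \subset B ->
  (forall y, y \in B -> exists M, [/\ connected_in M, M \subset B, y \in M
     & exists2 z, z \in M & z \in D]) ->
  connected_in B.
Proof.
move=> cD xD DB cov; apply: (@connected_from _ x) => y /cov[M [cM MB yM [z zM zD]]].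
exact: connect_trans (connectS DB (cD _ _ xD zD)) (connectS MB (cM _ _ zM yM)).
Qed.

Lemma connected1 x : connected_in [set x].
Proof. by move=> y z /set1P-> /set1P->; apply: connect0. Qed.

Lemma connectedU B1 B2 z : connected_in B1 -> connected_in B2 ->
  z \in B1 -> z \in B2 -> connected_in (B1 :|: B2).
Proof.
move=> c1 c2 z1 z2; apply: (connected_cover c1 z1 (subsetUl _ _)) => y.
case/setUP=> yB; first by exists B1; split=> //; [apply: subsetUl|exists z].
by exists B2; split=> //; [apply: subsetUr|exists z].
Qed.

Lemma connected_edge x y : sedge x y -> connected_in [set x; y].
Proof.
move=> xy; apply: (@connected_from _ x) => z /set2P[]->; first exact: connect0.
by apply: connect1; rewrite inrelE !inE !eqxx orbT.
Qed.

Lemma connectedU_adj B1 B2 : connected_in B1 -> connected_in B2 ->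
  adj B1 B2 -> connected_in (B1 :|: B2).
Proof.
move=> c1 c2 [x [y [xB yB xy]]].
have cx : connected_in (B1 :|: [set x; y]).
  by apply: (connectedU c1 (connected_edge xy) xB); rewrite !inE eqxx.
have -> : B1 :|: B2 = (B1 :|: [set x; y]) :|: B2.
  apply/setP=> z; rewrite !inE.
  case: (z =P x) => [->|_]; first by rewrite xB.
  by case: (z =P y) => [->|_]; rewrite ?yB ?orbT ?orbF.
by apply: (connectedU cx c2 _ yB); rewrite !inE eqxx !orbT.
Qed.

Lemma mem_component A x : x \in component A x.
Proof. by rewrite inE connect0. Qed.

Lemma component_sub A x : x \in A -> component A x \subset A.
Proof.
move=> xA; apply/subsetP=> y; rewrite inE => /connectP[p].
elim: p x xA => [|z p IHp] x xA /=; first by move=> _ ->.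
by case/andP=> /and3P[_ zA _]; apply: IHp.
Qed.

Lemma component_connected A x : connected_in (component A x).
Proof.
pose P y := (y \in component A x) && connect (inrel (component A x)) x y.
suff H y : connect (inrel A) x y -> P y.
  by apply: (@connected_from _ x) => y; rewrite inE => /H/andP[].
case/connectP=> p xp ->.
suff H w : P w -> path (inrel A) w p -> P (last w p).
  by apply: H xp; rewrite /P mem_component connect0.
elim: p w {xp} => [//|z p IHp] w /andP[wC xw] /= /andP[wz]; apply: IHp.
have zC : z \in component A x.
  by move: wC; rewrite !inE => /connect_trans; apply; apply: connect1.
rewrite /P zC; apply: connect_trans xw _; apply: connect1.
by rewrite inrelE wC zC; case/and3P: wz.
Qed.

Lemma component_max A B x z : connected_in B -> B \subset A -> z \in B ->
  z \in component A x -> B \subset component A x.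
Proof.
move=> cB BA zB zx; apply/subsetP=> y yB.
move: zx; rewrite !inE => /connect_trans; apply.
exact: connectS BA (cB _ _ zB yB).
Qed.

Lemma component_closed A x y z : x \in A -> y \in component A x -> z \in A ->
  sedge y z -> z \in component A x.
Proof.
move=> xA yC zA yz; have yA := subsetP (component_sub xA) y yC.
move: yC; rewrite !inE => /connect_trans; apply; apply: connect1.
by rewrite inrelE yA zA.
Qed.

Lemma component_eq A x y : y \in component A x -> component A y = component A x.
Proof.
rewrite inE => xy; apply/setP=> z; rewrite !inE.
apply/idP/idP; first exact: connect_trans.
by apply: connect_trans; rewrite connectC.
Qed.

Lemma component_adj A K x : connected_in A -> K \subset A -> K != set0 ->
  x \in A :\: K -> adj (component (A :\: K) x) K.
Proof.
move=> cA KA /set0Pn[k kK] xAK; apply: contrapT => nadj.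
have xA : x \in A by case/setDP: xAK.
suff /subsetP/(_ k) : K \subset component (A :\: K) x.
  move=> /(_ kK) /(subsetP (component_sub xAK)); by rewrite inE kK.
apply/subsetP=> y /(subsetP KA); move: y.
apply: (connected_ind cA xA (mem_component _ _)) => u v uA vA uC uv.
case vK: (v \in K); first by case: nadj; exists u, v.
by apply: component_closed uv => //; rewrite inE vK.
Qed.

Lemma component_id A x : connected_in A -> x \in A -> component A x = A.
Proof.
move=> cA xA; apply/eqP; rewrite eqEsubset component_sub //=.
exact: component_max cA (subxx _) xA (mem_component _ _).
Qed.

(** What remains is [K] with the other components of [A :\: K], and each of these touches [K]
    because [A] is connected. *)
Lemma component_coconnected A K x : connected_in A -> connected_in K ->
  K \subset A -> K != set0 -> x \in A :\: K ->
  connected_in (A :\: component (A :\: K) x).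
Proof.
move=> cA cK KA K0 xAK; have [k kK] := set0Pn _ K0.
have KAC : K \subset A :\: component (A :\: K) x.
  rewrite subsetD KA disjoint_sym disjoints_subset /=.
  apply: subset_trans (component_sub xAK) _.
  by apply/subsetP=> z; rewrite !inE => /andP[].
apply: (connected_cover cK kK KAC) => y; rewrite inE => /andP[yC yA].
case yK: (y \in K); first by exists K; split=> //; exists k.
have yAK : y \in A :\: K by rewrite inE yK.
exists (component (A :\: K) y :|: K); split.
- apply: connectedU_adj => //; first exact: component_connected.
  exact: component_adj.
- rewrite subUset KAC andbT subsetD; apply/andP; split.
    exact: subset_trans (component_sub yAK) (subsetDl _ _).
  rewrite disjoints_subset; apply/subsetP=> z zy; rewrite inE.
  apply/negP=> zx; case/negP: yC.
  by rewrite -(component_eq zx) (component_eq zy) mem_component.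
- by rewrite inE mem_component.
- by exists k; rewrite // inE kK orbT.
Qed.

Lemma connected_boundary A K x y : connected_in A -> x \in A -> x \in K ->
  y \in A -> y \notin K -> exists u v, [/\ u \in A, u \in K, v \in A, v \notin K & sedge u v].
Proof.
move=> cA xA xK yA yK; apply: contrapT => nb.
suff: y \in K by rewrite (negPf yK).
move: y yA {yK}; apply: (connected_ind cA xA xK) => u v uA vA uK uv.
by apply: contrapT => /negP vK; apply: nb; exists u, v.
Qed.

Lemma path_connected x p : path (@sedge G) x p -> connected_in [set y in x :: p].
Proof.
elim: p x => [|z p IHp] x /=.
  by move=> _; have -> : [set y in [:: x]] = [set x];
    [apply/setP=> y; rewrite !inE|apply: connected1].
case/andP=> xz /IHp cp.
have -> : [set y in [:: x, z & p]] = [set x] :|: [set y in z :: p].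
  by apply/setP=> y; rewrite !inE.
apply: connectedU_adj; [exact: connected1|exact: cp|].
by exists x, z; split; rewrite ?inE ?eqxx.
Qed.

(* [cov A K n]: the neighbourhood of [K] in [A] meets at most [n] connected
   pieces of [A :\: K]. *)
Definition cov A K n : Prop := exists2 E : seq {set G}, size E <= n &
  (forall e, e \in E -> [/\ connected_in e, e \subset A & [disjoint e & K]]) /\
  (forall y z, y \in K -> z \in A -> z \notin K -> sedge y z ->
     exists2 e, e \in E & z \in e).

Lemma covW A K n m : n <= m -> cov A K n -> cov A K m.
Proof. by move=> nm [E sE EP]; exists E => //; apply: leq_trans nm. Qed.

Lemma cov_trans A C K n m : K \subset C -> C \subset A ->
  cov A C n -> cov C K m -> cov A K (n + m).
Proof.
move=> KC CA [E sE [E1 E2]] [F sF [F1 F2]]; exists (E ++ F).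
  by rewrite size_cat leq_add.
split=> [e|y z yK zA zK yz].
  rewrite mem_cat => /orP[/E1|/F1] [ce eA dK]; split=> //.
    exact: disjointWr KC dK.
  exact: subset_trans eA CA.
case zC: (z \in C).
  by have [e eF ze] := F2 y z yK zC zK yz; exists e; rewrite ?mem_cat ?eF ?orbT.
have [e eE ze] := E2 y z (subsetP KC _ yK) zA (negbT zC) yz.
by exists e; rewrite ?mem_cat ?eE.
Qed.

Lemma cov_component A K x : connected_in K -> K \subset A -> x \in A :\: K ->
  cov A (component (A :\: K) x) 1.
Proof.
move=> cK KA xAK; exists [:: K] => //; split=> [e|y z yC zA zC yz].
  rewrite inE => /eqP->; split=> //; rewrite disjoint_sym disjoints_subset.
  apply: subset_trans (component_sub xAK) _.
  by apply/subsetP=> z; rewrite !inE => /andP[].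
exists K; rewrite ?mem_head //; apply: contrapT => /negP zK; case/negP: zC.
by apply: component_closed yz; rewrite // inE zK.
Qed.

Lemma cov_self A n : cov A A n.
Proof. by exists [::] => //; split=> // y z _ ->. Qed.

End Connectivity.

(** * Cuts from tree decompositions *)

(** The gate [g] is the end in [N] of an edge [z g] leaving the component of [y] outside [N]. A
    connected set from [y] to [N] avoiding [g] would, with that component and [N], link [z] to [g]
    without the edge [z g] and so close a cycle. *)
Lemma gate (T : sgraph) (N : {set T}) y : is_tree T -> connected_in N ->
  N != set0 -> y \notin N ->
  exists2 g, g \in N & forall (M : {set T}) n, connected_in M -> y \in M ->
    n \in M -> n \in N -> g \in M.
Proof.
move=> [_ cT acyc] cN N0 yN; have yTN : y \in [set: T] :\: N by rewrite !inE yN.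
have [z [g [zK gN zg]]] := component_adj cT (subsetT N) N0 yTN.
exists g => // M n cM yM nM nN; apply: contrapT => /negP gM.
pose K := component ([set: T] :\: N) y.
have KN u : u \in K -> u \notin N.
  by move=> /(subsetP (component_sub yTN)); rewrite !inE andbT.
have zN : z \notin N by apply: KN.
pose e' : rel T := [rel u v | sedge u v && ((u \notin [set z; g]) || (v \notin [set z; g]))].
have sub (B : {set T}) u v : ~~ ((z \in B) && (g \in B)) ->
    connect (inrel B) u v -> connect e' u v.
  move=> zgB; apply: connect_sub => a b /and3P[aB bB ab]; apply: connect1.
  rewrite /e' /= ab /=; apply/negPn/negP; rewrite negb_or !negbK !inE.
  case/andP=> /orP[]/eqP ea /orP[]/eqP eb; move: zgB ab aB bB;
    by rewrite ea eb ?sedge_irr // => /negbTE h _ h1 h2; rewrite h1 h2 in h.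
have /connectP[p] : connect e' z g.
  apply: (@connect_trans _ _ y).
    apply: (sub K); first by apply/negP => /andP[_ /KN]; rewrite gN.
    by apply: component_connected => //; apply: mem_component.
  apply: (@connect_trans _ _ n); first by apply: (sub M); [rewrite (negPf gM) andbF|apply: cM].
  by apply: (sub N); [rewrite (negPf zN)|apply: cN].
case/shortenP=> q zq uq _ lq.
have zq' : path (@sedge T) z q by apply: sub_path zq => a b /andP[].
apply: (acyc (z :: q)).
  case: q zq lq {uq zq'} => [|a [|b q]] //=.
    by move=> _ ezg; rewrite ezg (negPf zN) in gN.
  by rewrite /e' /= => /andP[+ _] ega; rewrite -ega !inE !eqxx orbT andbF.
rewrite /ucycle uq andbT /= rcons_path zq' -lq.
by rewrite sedge_sym.
Qed.

Section TreeDecomposition.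
Variables (G T : sgraph) (W : T -> {set G}).
Hypothesis tdW : is_tree_decomposition W.
Implicit Types (A B C D E H K M : {set G}) (u v x z : G) (y t : T).

Definition nodes K : {set T} := [set t | W t :&: K != set0].

Lemma mem_nodes K t u : u \in W t -> u \in K -> t \in nodes K.
Proof. by move=> uW uK; rewrite inE; apply/set0Pn; exists u; rewrite inE uW. Qed.

Lemma nodesP K t : reflect (exists2 u, u \in W t & u \in K) (t \in nodes K).
Proof.
rewrite inE; apply: (iffP (set0Pn _)) => [[u /setIP[]]|[u uW uK]]; exists u => //.
by rewrite inE uW.
Qed.

Lemma nodes_connected K : connected_in K -> connected_in (nodes K).
Proof.
case: tdW => _ cV cE cN cK s t /nodesP[u uW uK] /nodesP[v vW vK].
suff: forall t', v \in W t' -> connect (inrel (nodes K)) s t' by apply.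
move: v vK {t vW}; apply: (connected_ind cK uK) => [t uWt|a b aK bK IH ab t bt].
  apply: (@connectS _ [set x | u \in W x]).
    by apply/subsetP=> x; rewrite inE => ux; apply: mem_nodes ux uK.
  by apply: cN; rewrite inE.
have [t' /andP[at' bt']] := cE _ _ ab.
apply: connect_trans (IH _ at') _; apply: (@connectS _ [set x | b \in W x]).
  by apply/subsetP=> x; rewrite inE => ux; apply: mem_nodes ux bK.
by apply: cN; rewrite inE.
Qed.

Lemma nodes_nonempty K : K != set0 -> nodes K != set0.
Proof.
case: tdW => _ cV _ _ /set0Pn[u uK]; have [t ut] := cV u.
by apply/set0Pn; exists t; apply: mem_nodes ut uK.
Qed.

(** Every set of [E] is added in full to each bag that it meets. Such a set then fits into one bag,
    while bags grow only by vertices of these sets. *)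
Definition td_close (E : seq {set G}) t : {set G} :=
  W t :|: [set v | has (fun e : {set G} => (v \in e) && (t \in nodes e)) E].

Lemma td_closeP (E : seq {set G}) : (forall e, e \in E -> connected_in e) ->
  is_tree_decomposition (td_close E).
Proof.
case: (tdW) => tT cV cE cN cEE; split=> // [u|u v uv|u].
- by have [t ut] := cV u; exists t; rewrite inE ut.
- have [t /andP[ut vt]] := cE _ _ uv; exists t; by rewrite !inE ut vt.
have [t ut] := cV u.
apply: (@connected_cover _ [set x | u \in W x] _ t (cN u)); first by rewrite inE.
  by apply/subsetP=> x; rewrite !inE => ->.
move=> s; rewrite inE => /setUP[us|].
  exists [set x | u \in W x]; split.
  - exact: cN.
  - by apply/subsetP=> x; rewrite !inE => ->.
  - by rewrite inE.
  - by exists t; rewrite inE.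
rewrite inE => /hasP[e eE /andP[ue se]]; exists (nodes e); split=> //.
- by apply: nodes_connected; apply: cEE.
- apply/subsetP=> x xe; rewrite inE; apply/setUP; right; rewrite inE; apply/hasP.
  by exists e => //; rewrite ue.
- by exists t; [apply: mem_nodes ut ue|rewrite inE].
Qed.

Section Cut.
Variables (A : {set G}) (v0 : G) (Phi : {set G} -> Prop).
Hypotheses (cA : connected_in A) (v0A : v0 \in A).
(** [Hc K] is the hull of [K] seen from the root [v0]: for [K] inside [A] and missing [v0], it is
    the least superset of [K] that misses [v0] and has a connected complement in [A]. *)
Let D K := component (A :\: K) v0.
Let Hc K := A :\: D K.

Section OneSet.
Variable K : {set G}.
Hypotheses (cK : connected_in K) (KA : K \subset A) (K0 : K != set0) (v0K : v0 \notin K).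

Let v0AK : v0 \in A :\: K. Proof. by rewrite inE v0K. Qed.

Let D_sub u : u \in D K -> u \in A /\ u \notin K.
Proof. by move/(subsetP (component_sub v0AK)); rewrite inE => /andP[]. Qed.

Let K_Hc : K \subset Hc K.
Proof.
apply/subsetP=> u uK; rewrite inE (subsetP KA _ uK) andbT.
by apply/negP=> /D_sub[_]; rewrite uK.
Qed.

Let v0_Hc : v0 \notin Hc K.
Proof. by rewrite inE mem_component. Qed.

Let Hc_C : A :\: Hc K = D K.
Proof.
apply/setP=> u; rewrite !inE negb_and negbK.
case uD: (connect _ _ _) => /=; last by rewrite andNb.
by have [|->] := @D_sub u; rewrite ?inE.
Qed.

Let Hc_edge u z : u \in Hc K -> z \in D K -> sedge u z -> u \in K.
Proof.
rewrite inE => /andP[uD uA] zD uz; apply: contrapT => /negP uK.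
case/negP: uD; apply: (component_closed v0AK zD); first by rewrite inE uK.
by rewrite sedge_sym.
Qed.

Let Hc_connected : connected_in (Hc K).
Proof.
have [k kK] := set0Pn _ K0.
apply: (connected_cover cK kK K_Hc) => y; rewrite inE => /andP[yD yA].
case yK: (y \in K).
  by exists K; split=> //; exists k.
have yAK : y \in A :\: K by rewrite inE yK.
have ad := component_adj cA KA K0 yAK.
exists (component (A :\: K) y :|: K); split.
- by apply: connectedU_adj ad => //; apply: component_connected.
- apply/subsetP=> z /setUP[zC|]; last exact: (subsetP K_Hc).
  have zAK := subsetP (component_sub yAK) _ zC.
  rewrite inE; apply/andP; split; last by case/setDP: zAK.
  apply/negP=> /component_eq; rewrite (component_eq zC) => e.
  by case/negP: yD; rewrite /D -e mem_component.
- by rewrite inE mem_component.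
- by exists k; rewrite // inE kK orbT.
Qed.

Let Hc_sub H : connected_in (A :\: H) -> v0 \notin H -> K \subset H -> Hc K \subset H.
Proof.
move=> cH v0H KH; apply/subsetP=> u; rewrite inE => /andP[uD uA].
apply: contrapT => /negP uH; case/negP: uD.
have AHK : A :\: H \subset A :\: K by apply: setDS.
by apply: (subsetP (component_max cH AHK _ (mem_component _ _)));
  rewrite inE ?v0H ?uH.
Qed.

Lemma hullP : [/\ K \subset Hc K, v0 \notin Hc K, A :\: Hc K = D K,
    connected_in (Hc K) &
    (forall u z, u \in Hc K -> z \in D K -> sedge u z -> u \in K) /\
    (forall H, connected_in (A :\: H) -> v0 \notin H -> K \subset H -> Hc K \subset H)].
Proof. by []. Qed.

(** The set [K :|: D K] is connected, contains [v0] and misses [K'], so it stays on the side of [v0]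
    when [K'] is removed. Taking complements gives the inclusion. *)
Lemma hull_far K' : connected_in K' -> K' \subset A -> [disjoint K & K'] ->
  ~~ (K' \subset D K) -> v0 \notin K' -> Hc K' \subset Hc K :\: K.
Proof.
move=> cK' K'A dK K'D v0K'; have [a aK' aD] := subsetPn K'D.
have DK' : [disjoint K :|: D K & K'].
  rewrite disjoints_subset subUset -disjoints_subset dK /=.
  apply/subsetP=> z zD; rewrite inE.
  apply/negP=> zK'; case/negP: aD.
  apply: (subsetP (component_max cK' _ zK' zD)) => //.
  by rewrite subsetD K'A disjoint_sym.
have cKD : connected_in (K :|: D K).
  apply: connectedU_adj => //; first exact: component_connected.
  by apply: adjC; apply: component_adj.
have v0KD : v0 \in K :|: D K by rewrite inE mem_component orbT.
have /subsetP KD : K :|: D K \subset D K'.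
  apply: component_max cKD _ v0KD (mem_component _ _).
  by rewrite subsetD DK' andbT subUset KA; apply/subsetP=> z /D_sub[].
apply/subsetP=> z; rewrite !inE => /andP[zD zA].
rewrite zA andbT; apply/andP; split.
  by apply: contra zD => zK; have := KD z; rewrite !inE zK; apply.
by apply: contra zD => zK; have := KD z; rewrite !inE zK orbT; apply.
Qed.

End OneSet.

Definition is_cut H0 H y : Prop :=
  [/\ H \subset H0, connected_in H, connected_in (A :\: H), Phi H
    & (forall u z, u \in H -> z \in A :\: H -> sedge u z -> z \in W y) /\
      forall x, x \in H :\: W y -> ~ Phi (Hc (component (A :\: W y) x))].

Lemma part_sub H y x : v0 \notin H -> H \subset A ->
  (forall u z, u \in H -> z \in A :\: H -> sedge u z -> z \in W y) ->
  x \in H :\: W y ->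
  [/\ x \in A :\: W y, component (A :\: W y) x \subset A :\: W y,
      component (A :\: W y) x \subset H & v0 \notin component (A :\: W y) x].
Proof.
move=> v0H HA NH /setDP[xH xW].
have xAW : x \in A :\: W y by rewrite inE xW (subsetP HA).
have s1 := component_sub xAW.
have s2 : component (A :\: W y) x \subset H.
  apply/subsetP; apply: (connected_ind (@component_connected _ _ _) (mem_component _ _) xH).
  move=> u v uC vC uH uv; apply: contrapT => /negP vH.
  have /setDP[vA] := subsetP s1 _ vC; rewrite (NH u v) //.
  by rewrite inE vH.
by split=> //; apply: contra v0H; apply: (subsetP s2).
Qed.

(** Descent on the size of the hull, then on the size of [K]. From the bag [y] one moves to the gate
    [g] of the nodes of [K]. If a part beyond the bag of [g] still has a hull with [Phi], the step
    is repeated from that part; otherwise the hull of [K] is the cut. *)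
Lemma cut_step y K x : x \in A :\: W y -> K = component (A :\: W y) x ->
  v0 \notin K -> Phi (Hc K) -> exists H t, is_cut (Hc K) H t.
Proof.
move: {-1}#|Hc K| (leqnn #|Hc K|) => n; elim/ltn_ind: n y K x => n IHn y K.
move: {-1}#|K| (leqnn #|K|) => m; elim/ltn_ind: m y K => m IHm y K leK x leH xAW eK v0K PK.
have KAW : K \subset A :\: W y by rewrite eK; apply: component_sub.
have KA : K \subset A := subset_trans KAW (subsetDl _ _).
have cK : connected_in K by rewrite eK; apply: component_connected.
have xK : x \in K by rewrite eK mem_component.
have K0 : K != set0 by apply/set0Pn; exists x.
have [KH v0H HC cH [Hedge Hsub]] := hullP cK KA K0 v0K.
have yN : y \notin nodes K.
  by apply/nodesP=> -[u uW /(subsetP KAW)]; rewrite inE uW.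
case: (tdW) => tT cV cE cN.
have [g gN gM] := gate tT (nodes_connected cK) (nodes_nonempty K0) yN.
(* An edge leaving the hull starts in [K] and ends in [W y]. The nodes of its outer end are
   connected, contain [y] and meet the nodes of [K], hence contain the gate. *)
have NHg u z : u \in Hc K -> z \in A :\: Hc K -> sedge u z -> z \in W g.
  rewrite HC => uH zD uz; have uK := Hedge u z uH zD uz.
  have zAK : z \in A :\: K.
    by apply: (subsetP (component_sub _)) zD; rewrite inE v0K.
  case/setDP: zAK => zA zK.
  have zW : z \in W y.
    apply: contrapT => /negP zW; case/negP: zK; rewrite eK.
    by apply: (component_closed xAW _ _ uz); rewrite -?eK // inE zW.
  have [t /andP[ut zt]] := cE _ _ uz.
  suff: g \in [set t | z \in W t] by rewrite inE.
  by apply: (gM _ t (cN z)); [rewrite inE|rewrite inE|apply: mem_nodes ut uK].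
have cAH : connected_in (A :\: Hc K) by rewrite HC; apply: component_connected.
case: (pselect (exists2 x', x' \in Hc K :\: W g & Phi (Hc (component (A :\: W g) x')))); last first.
  move=> nx; exists (Hc K), g; split=> //; split=> // x' x'H Px; by apply: nx; exists x'.
case=> x' x'H Px'.
have [x'AW K'AW K'H v0K'] := part_sub v0H (subsetDl _ _) NHg x'H.
set K' := component _ _ in Px' K'AW K'H v0K'.
have cK' : connected_in K' by apply: component_connected.
have K'A : K' \subset A := subset_trans K'AW (subsetDl _ _).
have x'K' : x' \in K' by apply: mem_component.
have K'0 : K' != set0 by apply/set0Pn; exists x'.
have [_ _ _ _ [_ Hsub']] := hullP cK' K'A K'0 v0K'.
have HH : Hc K' \subset Hc K by apply: Hsub'.
suff [H [t [H1 H2 H3 H4 H5]]] : exists H t, is_cut (Hc K') H t.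
  by exists H, t; split=> //; apply: subset_trans HH.
(* If [K'] misses [K], then [hull_far] makes the hull shrink. *)
case: (boolP [disjoint K & K']) => dK.
  apply: (IHn #|Hc K'| _ _ _ _ (leqnn _) x'AW erefl v0K' Px').
  apply: leq_trans leH; apply: (@leq_ltn_trans #|Hc K :\: K|).
    apply/subset_leq_card/(hull_far cK KA K0 v0K cK' K'A dK _ v0K').
    apply/negP=> /subsetP/(_ _ x'K'); rewrite -HC => /setDP[_].
    by rewrite (subsetP K'H).
  apply: proper_card; rewrite properE subsetDl; apply/subsetPn.
  by exists x; [apply: (subsetP KH)|rewrite inE xK].
have [a /andP[aK aK']] := pred0Pn dK.
(* If [K'] meets [K], it cannot meet [W y]: its nodes would contain the gate, although [K'] avoids
   [W g]. So [K'] is inside [K], and properly so because [K] meets [W g]. *)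
have K'W : K' \subset A :\: W y.
  rewrite subsetD K'A disjoint_subset; apply/subsetP=> s sK'; rewrite inE.
  apply/negP=> sW; have [t ta] := cV a.
  have /nodesP[b bW bK'] : g \in nodes K'.
    apply: (gM _ t (nodes_connected cK')); [exact: mem_nodes sW sK'|exact: mem_nodes ta aK'|].
    exact: mem_nodes ta aK.
  by have := subsetP K'AW _ bK'; rewrite inE bW.
have K'K : K' \subset K.
  by rewrite eK; apply: component_max K'W aK' _; rewrite // -eK.
apply: (IHm #|K'| _ _ _ (leqnn _) _ _ x'AW erefl v0K' Px').
  apply: leq_trans leK; apply: proper_card; rewrite properE K'K.
  have /nodesP[b bW bK] := gN; apply/subsetPn; exists b => //.
  by apply/negP=> /(subsetP K'AW); rewrite inE bW.
by apply: leq_trans leH; apply: subset_leq_card.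
Qed.

Lemma cut_exists H0 y0 : connected_in H0 -> H0 \subset A ->
  connected_in (A :\: H0) -> v0 \notin H0 -> Phi H0 ->
  (forall u z, u \in H0 -> z \in A :\: H0 -> sedge u z -> z \in W y0) ->
  exists H y, is_cut H0 H y.
Proof.
move=> cH HA cAH v0H PH NH.
case: (pselect (exists2 x, x \in H0 :\: W y0 & Phi (Hc (component (A :\: W y0) x)))); last first.
  by move=> nx; exists H0, y0; split=> //; split=> // x xH Px; apply: nx; exists x.
case=> x xH Px; have [xAW KAW KH v0K] := part_sub v0H HA NH xH.
have [H [t [H1 H2 H3 H4 H5]]] := cut_step xAW erefl v0K Px.
exists H, t; split=> //; apply: subset_trans H1 _.
have KA := subset_trans KAW (subsetDl _ _).
have K0 : component (A :\: W y0) x != set0 by apply/set0Pn; exists x; apply: mem_component.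
have [_ _ _ _ [_ Hsub]] := hullP (@component_connected _ _ _) KA K0 v0K.
exact: Hsub.
Qed.

(** The bag of a cut is trimmed to [H] and its neighbours, and everything inside the hulls of the
    leftover parts is taken out of it. Each component of [H :\: S] then lies in a single hull, whose
    complement serves as [E]. *)
Lemma cut_clean H0 y0 : connected_in H0 -> H0 \subset A ->
  connected_in (A :\: H0) -> v0 \notin H0 -> Phi H0 ->
  (forall u z, u \in H0 -> z \in A :\: H0 -> sedge u z -> z \in W y0) ->
  exists (H S : {set G}) (y : T),
    [/\ H \subset H0, connected_in H, connected_in (A :\: H) & Phi H] /\
    [/\ S \subset W y, S \subset A,
       forall u z, u \in H -> z \in A :\: H -> sedge u z -> z \in S,
       forall z, z \in S -> z \notin H -> exists2 u, u \in H & sedge u z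
     & forall x, x \in H :\: S -> exists2 E, ~ Phi (A :\: E) &
         [/\ connected_in E, v0 \in E, E \subset A, A :\: E \subset H :\: S
           & component (H :\: S) x \subset A :\: E]].
Proof.
move=> cH0 H0A cAH0 v0H0 PH0 NH0.
have [H [y [HH0 cH cAH PH [NH nP]]]] := cut_exists cH0 H0A cAH0 v0H0 PH0 NH0.
have HA := subset_trans HH0 H0A.
have v0H : v0 \notin H by apply: contra v0H0; apply: (subsetP HH0).
pose part x := component (A :\: W y) x.
have partP x : x \in H :\: W y -> [/\ x \in A :\: W y, part x \subset A :\: W y,
    part x \subset H & v0 \notin part x] by apply: part_sub.
have partH x (xP : x \in H :\: W y) : [/\ part x \subset Hc (part x), v0 \notin Hc (part x),
    A :\: Hc (part x) = D (part x), Hc (part x) \subset H &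
    forall u z, u \in Hc (part x) -> z \in D (part x) -> sedge u z -> u \in part x].
  have [xAW pAW pH v0p] := partP x xP.
  have p0 : part x != set0 by apply/set0Pn; exists x; apply: mem_component.
  have [h1 h2 h3 _ [h5 h6]] := hullP (@component_connected _ _ _)
    (subset_trans pAW (subsetDl _ _)) p0 v0p.
  by split=> //; apply: h6.
pose N := [set z | [exists u in H, sedge u z]].
pose I := \bigcup_(x in H :\: W y) Hc (part x).
pose S := (W y :&: A :&: (H :|: N)) :\: I.
have IH : I \subset H by apply/bigcupsP => x /partH[].
have SI x : x \in H -> x \notin S -> x \in I.
  move=> xH xS; apply: contraR xS => xI.
  rewrite !inE xI xH (subsetP HA _ xH) /= !andbT.
  apply: contraR xI => xW; apply/bigcupP; exists x; first by rewrite inE xW.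
  have xHW : x \in H :\: W y by rewrite inE xW.
  have [pH _ _ _ _] := partH x xHW.
  by apply: (subsetP pH); apply: mem_component.
exists H, S, y; split=> //; split.
- by apply/subsetP=> z; rewrite !inE => /andP[_ /andP[/andP[]]].
- by apply/subsetP=> z; rewrite !inE => /andP[_ /andP[/andP[]]].
- move=> u z uH zAH uz; have /setDP[zA zH] := zAH.
  rewrite inE; apply/andP; split; first by apply: contra zH; apply: (subsetP IH).
  rewrite 3!inE (NH u z) // zA /=; apply/orP; right; rewrite inE.
  by apply/existsP; exists u; rewrite uH.
- move=> z; rewrite 2!inE => /andP[_ /andP[_ /setUP[->//|]]].
  by rewrite inE => /existsP[u /andP[uH uz]] _; exists u.
move=> x /setDP[xH xS]; have /bigcupP[t0 t0P xt0] := SI x xH xS.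
(* A largest hull containing [x] holds the whole component of [x]: an edge leaving it leads into the
   hull of another part, and either one hull contains the other, or the edge joins two different
   components of [A :\: W y]; both are impossible. *)
case: (@arg_maxnP _ t0 (fun t : G => (t \in H :\: W y) && (x \in Hc (part t)))
   (fun t : G => #|Hc (part t)|)); first by rewrite t0P xt0.
move=> t /andP[tP xt] tmax {t0 t0P xt0}.
have [pt v0t HCt tH edget] := partH t tP.
exists (D (part t)); first exact: nP.
have Dt : D (part t) \subset A by rewrite -HCt subsetDl.
split=> //; first exact: component_connected.
- exact: mem_component.
- rewrite -/(Hc _) subsetD tH disjoint_sym disjoints_subset.
  apply/subsetP=> z; rewrite inE => /andP[zI _]; rewrite inE.
  by apply: contra zI => zt; apply/bigcupP; exists t.
have xHS : x \in H :\: S by rewrite inE xS.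
apply/subsetP; apply: (connected_ind (@component_connected _ _ _) (mem_component _ _) xt).
move=> u v uC vC ut uv; apply: contrapT => /negP vt.
have /setDP[vH vS] := subsetP (component_sub xHS) _ vC.
have vD : v \in D (part t) by rewrite -HCt inE vt (subsetP HA).
have utp := edget u v ut vD uv.
have /bigcupP[s sP vs] := SI v vH vS.
have [ps v0s HCs sH edges] := partH s sP.
have [tAW tAW' tH' v0pt] := partP t tP.
have [sAW sAW' sH' v0ps] := partP s sP.
have ct : connected_in (part t) by apply: component_connected.
have cs : connected_in (part s) by apply: component_connected.
have tA := subset_trans tAW' (subsetDl _ _).
have sA := subset_trans sAW' (subsetDl _ _).
have t0 : part t != set0 by apply/set0Pn; exists t; apply: mem_component.
have s0 : part s != set0 by apply/set0Pn; exists s; apply: mem_component.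
case: (boolP [disjoint part t & part s]) => [dts|]; last first.
  case/pred0Pn=> a /andP[/= aT aS]; case/negP: vt.
  by rewrite [part t](_ : _ = part s) // /part -(component_eq aT) -(component_eq aS).
have sD : part s \subset D (part t).
  apply: contrapT => /negP sD; have := hull_far ct tA t0 v0pt cs sA dts sD v0ps.
  by move=> /subsetP/(_ v vs); rewrite inE (negPf vt) andbF.
have tD : part t \subset D (part s).
  apply: contrapT => /negP tD; rewrite disjoint_sym in dts.
  have /subsetP hs := hull_far cs sA s0 v0ps ct tA dts tD v0pt.
  have := tmax s; rewrite sP /=.
  have /setDP[xs _] := hs _ xt; rewrite xs => /(_ isT).
  apply/negP; rewrite -ltnNge; apply: proper_card; apply/properP; split.
    by apply/subsetP=> z /hs/setDP[].
  by exists v => //.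
have vps : v \in part s.
  by apply: (edges v u vs (subsetP tD _ utp)); rewrite sedge_sym.
have : v \in part t by apply: (component_closed tAW utp) uv; apply: (subsetP sAW').
by move=> vpt; case/negP: vt; apply: (subsetP pt).
Qed.

End Cut.
End TreeDecomposition.

(** * Weak reachability and splittings *)

Section Split.
Variables (G : sgraph) (r : nat).
Implicit Types (A B C D E H K M S : {set G}) (u v x y z : G).

(** Vertices outside [S] count as ranked above all of [S]. Ties are allowed; they only enlarge the
    set, so bounds survive any way of breaking them. *)
Definition wr C S (rho : G -> nat) u : {set G} :=
  [set v in S | `[< exists p, [/\ path (@sedge G) u p, last u p = v,
     {subset u :: p <= C}, size p <= r
     & forall w, w \in u :: p -> w \in S -> rho v <= rho w] >]].

Lemma wrP C S rho u v : reflect (v \in S /\ exists p,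
    [/\ path (@sedge G) u p, last u p = v, {subset u :: p <= C}, size p <= r
     & forall w, w \in u :: p -> w \in S -> rho v <= rho w])
  (v \in wr C S rho u).
Proof.
rewrite inE; apply: (iffP andP) => -[vS]; first by move/asboolP.
by move=> h; split=> //; apply/asboolP.
Qed.

Lemma wr_sub C S rho u : wr C S rho u \subset S.
Proof. by apply/subsetP=> v /wrP[]. Qed.

Section Glue.
Variables (C S1 : {set G}) (rho1 : G -> nat).
Variables (Sf : {set G} -> {set G}) (rf : {set G} -> G -> nat).
Hypothesis S1C : S1 \subset C.

Let part x := component (C :\: S1) x.
Definition glue_set : {set G} :=
  S1 :|: [set v in C :\: S1 | v \in Sf (component (C :\: S1) v)].

Definition glue_rank v : nat :=
  if v \in S1 then rho1 v
  else (\max_x rho1 x).+1 + rf (component (C :\: S1) v) v.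

Lemma glue_sub : glue_set \subset C.
Proof.
rewrite subUset S1C; apply/subsetP=> v; rewrite inE => /andP[+ _].
by case/setDP.
Qed.

(** A path ending in a vertex added later cannot meet [S1], whose ranks are lower. It stays in one
    component of [C :\: S1], where the ranks are those of that component up to a constant. *)
Lemma glue_wr u : u \in C ->
  wr C glue_set glue_rank u \subset wr C S1 rho1 u :|:
    (if u \in S1 then set0 else wr (part u) (Sf (part u)) (rf (part u)) u).
Proof.
move=> uC; apply/subsetP=> v /wrP[vS [p [up lp pC sp pS]]].
rewrite inE; apply/orP.
have vp : v \in u :: p by rewrite -lp mem_last.
case v1: (v \in S1).
  left; apply/wrP; split=> //; exists p; split=> // w wp w1.
  by have := pS w wp; rewrite /glue_set /glue_rank v1 w1 inE w1; apply.
right.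
have p1 w : w \in u :: p -> w \notin S1.
  move=> wp; apply/negP=> w1; have := pS w wp; rewrite /glue_set /glue_rank v1 w1 inE w1.
  move/(_ isT); apply/negP; rewrite -ltnNge ltn_addr // ltnS.
  exact: leq_bigmax.
rewrite (negPf (p1 u _)) ?mem_head //.
have pp w : w \in u :: p -> w \in part u.
  move=> wp; apply: (subsetP (component_max (path_connected up) _ _ (mem_component _ u))).
  - by apply/subsetP=> z; rewrite inE => zp; rewrite inE p1 // pC.
  - by rewrite inE mem_head.
  - by rewrite inE.
have pe w : w \in u :: p -> component (C :\: S1) w = part u.
  by move/pp/component_eq.
have vSf : v \in Sf (part u).
  by move: vS; rewrite /glue_set !inE v1 /= pe // => /andP[].
apply/wrP; split=> //; exists p; split=> // w wp wS.
have := pS w wp; rewrite /glue_rank /glue_set v1 (negPf (p1 w wp)) !pe // leq_add2l.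
by rewrite !inE pe // (negPf (p1 w wp)) pC //= wS; apply.
Qed.

Lemma glue_component x : x \in C :\: glue_set ->
  [/\ x \in C :\: S1, x \in part x :\: Sf (part x) &
      component (C :\: glue_set) x = component (part x :\: Sf (part x)) x].
Proof.
move=> xCg; have /setDP[xC] := xCg; rewrite in_setU negb_or => /andP[x1 xS].
have xCS : x \in C :\: S1 by rewrite inE x1.
have xpS : x \in part x :\: Sf (part x).
  by rewrite in_setD mem_component andbT; apply: contra xS => xSf; rewrite inE xCS.
split=> //; apply/eqP; rewrite eqEsubset; apply/andP; split.
  apply: component_max (@component_connected _ _ _) _ (mem_component _ _) (mem_component _ _).
  have sC := component_sub xCg.
  have sp : component (C :\: glue_set) x \subset part x.
    apply: component_max (@component_connected _ _ _) _ (mem_component _ _) (mem_component _ _).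
    by apply: subset_trans sC _; apply/setDS/subsetUl.
  apply/subsetP=> z zx; rewrite inE (subsetP sp) // andbT; apply/negP=> zSf.
  have /setDP[zC] := subsetP sC z zx; rewrite /glue_set 2!inE => /negP; apply.
  have zx' := subsetP sp z zx; apply/orP; right.
  have zCS := subsetP (component_sub xCS) _ zx'.
  by rewrite zCS (component_eq zx').
apply: component_max (@component_connected _ _ _) _ (mem_component _ _) (mem_component _ _).
apply: subset_trans (component_sub xpS) _; apply/subsetP=> z /setDP[zp zSf].
have /setDP[zC z1] := subsetP (component_sub xCS) _ zp.
by rewrite in_setD zC andbT in_setU negb_or z1 /= inE (component_eq zp) (negPf zSf) andbF.
Qed.

End Glue.

Definition split C k (Q : {set G} -> Prop) : Prop := exists S rho,
  [/\ S \subset C, forall u, u \in C -> #|wr C S rho u| <= k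
    & forall x, x \in C :\: S -> Q (component (C :\: S) x)].

Lemma splitW C k k' (Q Q' : {set G} -> Prop) : k <= k' ->
  (forall K, K \subset C -> connected_in K -> K != set0 -> Q K -> Q' K) ->
  split C k Q -> split C k' Q'.
Proof.
move=> kk QQ [S [rho [SC Sk SQ]]]; exists S, rho; split=> //.
  by move=> u uC; apply: leq_trans (Sk u uC) kk.
move=> x xCS; apply: QQ (SQ x xCS).
- exact: subset_trans (component_sub xCS) (subsetDl _ _).
- exact: component_connected.
- by apply/set0Pn; exists x; apply: mem_component.
Qed.

Lemma split_small C S k (Q : {set G} -> Prop) : S \subset C -> #|S| <= k ->
  (forall x, x \in C :\: S -> Q (component (C :\: S) x)) -> split C k Q.
Proof.
move=> SC Sk SQ; exists S, (fun=> 0); split=> // u uC.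
exact: leq_trans (subset_leq_card (wr_sub _ _ _ _)) Sk.
Qed.

Lemma split0 C (Q : {set G} -> Prop) : connected_in C -> Q C -> split C 0 Q.
Proof.
move=> cC QC; apply: (@split_small _ set0); rewrite ?sub0set ?cards0 // => x.
by rewrite setD0 => xC; rewrite component_id.
Qed.

(** The components are split independently, and a vertex sees the splitting of its own component
    only, so the costs add. *)
Lemma split_bind C a b (Q Q' : {set G} -> Prop) : split C a Q ->
  (forall K, K \subset C -> connected_in K -> K != set0 -> Q K -> split K b Q') ->
  split C (a + b) Q'.
Proof.
move=> [S1 [rho1 [S1C S1a S1Q]]] QQ.
have [f fP] : exists f : {set G} -> {set G} * (G -> nat), forall K,
    K \subset C -> connected_in K -> K != set0 -> Q K ->
    [/\ (f K).1 \subset K, forall u, u \in K -> #|wr K (f K).1 (f K).2 u| <= b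
    & forall x, x \in K :\: (f K).1 -> Q' (component (K :\: (f K).1) x)].
  suff /choice[f fP] : forall K, exists p : {set G} * (G -> nat),
      K \subset C -> connected_in K -> K != set0 -> Q K ->
      [/\ p.1 \subset K, forall u, u \in K -> #|wr K p.1 p.2 u| <= b
      & forall x, x \in K :\: p.1 -> Q' (component (K :\: p.1) x)] by exists f.
  move=> K; case: (pselect [/\ K \subset C, connected_in K, K != set0 & Q K]).
    by move=> [h1 h2 h3 /(QQ _ h1 h2 h3)[S [rho h]]]; exists (S, rho).
  by move=> n; exists (set0, fun=> 0) => h1 h2 h3 h4; case: n.
pose part x := component (C :\: S1) x.
have partP x : x \in C :\: S1 -> [/\ part x \subset C, connected_in (part x),
    part x != set0 & Q (part x)].
  move=> xCS; split; last exact: S1Q.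
  - exact: subset_trans (component_sub xCS) (subsetDl _ _).
  - exact: component_connected.
  - by apply/set0Pn; exists x; apply: mem_component.
pose Sf K := (f K).1; pose rf K := (f K).2.
exists (glue_set C S1 Sf), (glue_rank C S1 rho1 rf); split.
- exact: glue_sub.
- move=> u uC; have := @glue_wr C S1 rho1 Sf rf u uC.
  move=> /subset_leq_card/leq_trans; apply.
  apply: leq_trans (leq_card_setU _ _) _; apply: leq_add; first exact: S1a.
  case: ifP => [_|u1]; first by rewrite cards0.
  have uCS : u \in C :\: S1 by rewrite inE u1.
  have [h1 h2 h3 h4] := partP u uCS.
  by case: (fP _ h1 h2 h3 h4) => _ + _; apply; apply: mem_component.
move=> x /glue_component[xCS xp ->].
by have [h1 h2 h3 h4] := partP x xCS; case: (fP _ h1 h2 h3 h4) => _ _; apply.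
Qed.

End Split.

(** * Hitting sets for disjoint connected sets with a property *)

Section Bags.
Variables (G T : sgraph) (W : T -> {set G}) (w : nat).
Hypothesis tdW : is_tree_decomposition W.
Hypothesis Ww : forall t, #|W t| <= w.
Implicit Types (A B C D E H K M S R : {set G}) (u v x y z : G).

Definition packing (Psi : {set G} -> Prop) k B : Prop :=
  exists f : nat -> {set G},
    (forall i, i < k -> [/\ connected_in (f i), f i \subset B, f i != set0 & Psi (f i)]) /\
    (forall i j, i < j -> j < k -> [disjoint f i & f j]).

(** The bag may have grown, but only by vertices of the sets in [Es], which [B] avoids. *)
Lemma card_closed_bag (Es : seq {set G}) t S B :
  S \subset td_close W Es t -> B \subset S ->
  (forall e, e \in Es -> [disjoint e & B]) -> #|B| <= w.
Proof.
move=> /subsetP SW /subsetP BS dB; apply: leq_trans (Ww t).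
apply/subset_leq_card/subsetP=> z zB.
have := SW z (BS z zB); rewrite inE => /orP[//|].
rewrite inE => /hasP[e eE /andP[ze _]].
by have := disjointFr (dB e eE) ze; rewrite zB.
Qed.

(** An Erdos-Posa argument by induction on [k]: a minimal [H] with [Psi] is cut off by one bag, and
    it would extend any packing found in [A :\: H], so the packing number drops there. A component
    left inside [H] sees one connected set; any other sees at most one piece more, namely [H] with
    its neighbours. *)
Lemma hitting_set (Psi : {set G} -> Prop) k R A v0 :
  (forall B C, B \subset C -> Psi B -> Psi C) ->
  connected_in A -> connected_in R -> R \subset A -> v0 \in R ->
  ~ packing Psi k.+1 (A :\: R) ->
  exists S, [/\ S \subset A :\: R, #|S| <= k * w &
    forall x, x \in A :\: R :\: S ->
      ~ Psi (component (A :\: R :\: S) x) /\ cov A (component (A :\: R :\: S) x) k.+1].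
Proof.
move=> PsiS; elim: k A => [|k IHk] A cA cR RA v0R npk.
all: have R0 : R != set0 by apply/set0Pn; exists v0.
all: case: (pselect (exists2 x, x \in A :\: R & Psi (component (A :\: R) x))) => [[x xAR Px]|nx];
  last by (exists set0; rewrite sub0set cards0 setD0; split=> // x xAR; split;
    [by move=> Px; apply: nx; exists x|exact: (covW _ (cov_component cR RA xAR))]).
all: have C0 : component (A :\: R) x != set0 by apply/set0Pn; exists x; apply: mem_component.
  case: npk; exists (fun=> component (A :\: R) x); split=> [i _|i [|j]] //.
  by split=> //; [exact: component_connected|exact: component_sub].
have tdE : is_tree_decomposition (td_close W [:: R]).
  by apply: td_closeP => // e; rewrite inE => /eqP->.
case: (tdW) => _ cV _ _; have [y0 v0y] := cV v0.
(* After closing the decomposition under [R], the bag of [v0] contains all of [R], hence all outer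
   neighbours of the starting set [H0]. *)
have Ry0 : R \subset td_close W [:: R] y0.
  by apply/subsetP=> z zR; rewrite !inE /= zR (mem_nodes v0y v0R) orbT.
pose H0 := component (A :\: R) x.
have H0AR : H0 \subset A :\: R by apply: component_sub.
have H0A := subset_trans H0AR (subsetDl _ _).
have [||||||H [S1 [y [[HH0 cH cAH [Hn0 PH]] [S1W S1A NH S1H part]]]]] :=
    cut_clean tdE cA (subsetP RA _ v0R) (H0 := H0) (y0 := y0)
      (Phi := fun B => B != set0 /\ Psi B).
- exact: component_connected.
- exact: H0A.
- exact: component_coconnected.
- by apply/negP=> /(subsetP H0AR); rewrite inE v0R.
- by [].
- move=> u z uH /setDP[zA zH] uz; apply: (subsetP Ry0).
  apply: contrapT => /negP zR; case/negP: zH.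
  by apply: component_closed uz; rewrite // inE zR.
have HAR := subset_trans HH0 H0AR.
have dHR z : z \in H -> z \notin R by move/(subsetP HAR); rewrite inE => /andP[].
have HA := subset_trans HH0 H0A.
have RA' : R \subset A :\: H.
  by apply/subsetP=> z zR; rewrite inE (subsetP RA) // andbT; apply: contraL zR; apply: dHR.
have npk' : ~ packing Psi k.+1 ((A :\: H) :\: R).
  case=> f [fP fd]; apply: npk; exists (fun i => if i is i'.+1 then f i' else H); split.
    case=> [_|i /fP[h1 h2 h3 h4]]; split=> //.
    by apply: subset_trans h2 _; apply: setSD; apply: subsetDl.
  case=> [|i] [|j] // => [_ /fP[_ h _ _]|ij jk]; last exact: fd.
  rewrite disjoint_sym disjoints_subset; apply: subset_trans h _.
  by apply/subsetP=> z; rewrite !inE => /andP[_ /andP[]].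
have [S' [S'A S'w S'P]] := IHk _ cAH cR RA' v0R npk'.
exists ((S1 :\: R) :|: S').
have S1w : #|S1 :\: R| <= w.
  apply: (card_closed_bag S1W (subsetDl _ _)) => e; rewrite inE => /eqP->.
  by rewrite disjoints_subset; apply/subsetP=> z zR; rewrite !inE zR.
split.
- rewrite subUset setSD //=; apply: subset_trans S'A _.
  by apply: setSD; apply: subsetDl.
- by rewrite mulSn; apply: leq_trans (leq_card_setU _ _) _; apply: leq_add.
move=> a aP; set K := component _ a.
have aK : a \in K by apply: mem_component.
have cK : connected_in K by apply: component_connected.
have KP z : z \in K -> [/\ z \in A, z \notin R, z \notin S1 & z \notin S'].
  move/(subsetP (component_sub aP))/setDP=> [/setDP[zA zR]].
  by rewrite in_setU negb_or in_setD zR /= => /andP[].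
have Kclosed y' z : y' \in K -> z \in A -> z \notin K -> sedge y' z ->
    [\/ z \in R, z \in S1 | z \in S'].
  move=> yK zA zK yz; apply: contrapT => nz; case/negP: zK.
  apply: (component_closed aP yK _ yz); rewrite !inE zA andbT.
  case zR: (z \in R); first by case: nz; constructor 1.
  case z1: (z \in S1); first by case: nz; constructor 2.
  by case z2: (z \in S') => //; case: nz; constructor 3.
have KH : (exists2 b, b \in K & b \in H) -> K \subset H.
  case=> b bK bH; apply/subsetP; apply: (connected_ind cK bK bH) => u v uK vK uH uv.
  apply: contrapT => /negP vH; have [vA vR v1 _] := KP v vK.
  by case/negP: v1; apply: (NH u v); rewrite ?inE ?vH.
(* A component inside [H] lies in a hull without [Psi], and the connected complement [D] of that
   hull covers its neighbours. *)
case aH: (a \in H).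
  have KHs : K \subset H by apply: KH; exists a.
  have KHS : K \subset H :\: S1.
    by apply/subsetP=> z zK; rewrite inE (subsetP KHs) // andbT; case: (KP z zK).
  have aHS : a \in H :\: S1 := subsetP KHS _ aK.
  have [D nD [cD v0D DA DHS CD]] := part a aHS.
  have KD : K \subset A :\: D.
    by apply: subset_trans CD; apply: component_max KHS aK (mem_component _ _).
  split.
    move/(PsiS _ _ KD) => PD; apply: nD; split=> //.
    by apply/set0Pn; exists a; apply: (subsetP KD).
  apply: (@covW _ _ _ 1) => //; exists [:: D] => //; split=> [e|y' z yK zA zK yz].
    rewrite inE => /eqP->; split=> //; rewrite disjoint_sym disjoints_subset.
    by apply: subset_trans KD _; apply/subsetP=> z; rewrite !inE => /andP[].
  exists D; rewrite ?mem_head //; apply: contrapT => /negP zD.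
  have /setDP[zH z1] : z \in H :\: S1 by apply: (subsetP DHS); rewrite inE zD.
  case: (Kclosed y' z yK zA zK yz) => [|zS1|/(subsetP S'A)].
  - by apply/negP; apply: dHR.
  - by rewrite zS1 in z1.
  - by rewrite !inE zH andbF.
have dKH z : z \in K -> z \notin H.
  by move=> zK; apply/negP=> zH; move: aH; rewrite (subsetP (KH _)) //; exists z.
have KA' : K \subset A :\: H :\: R :\: S'.
  apply/subsetP=> z zK; have [zA zR _ z'] := KP z zK.
  by rewrite !inE zA zR z' dKH.
have aA' := subsetP KA' _ aK.
have [nC [Es sE [E1 E2]]] := S'P a aA'.
set C1 := component _ a in nC E1 E2.
have KC1 : K \subset C1 by apply: component_max KA' aK (mem_component _ _).
split; first by move/(PsiS _ _ KC1).
pose N := [set z in A :\: H | [exists u in H, sedge u z]].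
have NS1 z : z \in N -> z \in S1.
  by rewrite inE => /andP[zAH /existsP[u /andP[uH uz]]]; apply: (NH u z).
exists ((H :|: N) :: Es) => //; split=> [e|y' z yK zA zK yz].
  rewrite inE => /predU1P[->|/E1[ce eA dK]]; last first.
    split=> //; first by apply: subset_trans eA (subsetDl _ _).
    exact: disjointWr KC1 dK.
  have [h hH] := set0Pn _ Hn0.
  split.
  - apply: (connected_cover cH hH (subsetUl _ _)) => z /setUP[zH|zN].
      by exists H; split=> //; [apply: subsetUl|exists h].
    have := zN; rewrite inE => /andP[_ /existsP[u /andP[uH uz]]].
    exists [set u; z]; split; first exact: connected_edge.
    + by apply/subsetP=> b; rewrite !in_set2 => /orP[]/eqP->; rewrite in_setU ?uH ?zN ?orbT.
    + by rewrite !inE eqxx orbT.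
    + by exists u; rewrite // !inE eqxx.
  - rewrite subUset HA; apply/subsetP=> z; rewrite !inE.
    by case/andP=> /andP[].
  - rewrite disjoint_sym disjoints_subset; apply/subsetP=> z zK.
    rewrite inE in_setU negb_or dKH //=; have [_ _ z1 _] := KP z zK.
    by apply: contra z1; apply: NS1.
have [zH|zH] := boolP (z \in H).
  have [_ _ y1 _] := KP y' yK; case/negP: y1; apply: (NH z y' zH).
    by rewrite inE dKH //; case: (KP y' yK).
  by rewrite sedge_sym.
have zAH : z \in A :\: H by rewrite inE zH.
have [zC|zC] := boolP (z \in C1); last first.
  have [e eE ze] := E2 y' z (subsetP KC1 _ yK) zAH zC yz.
  by exists e; rewrite // inE eE orbT.
exists (H :|: N); rewrite ?mem_head //.
have := subsetP (component_sub aA') _ zC; rewrite !inE => /andP[zS' /andP[zR _]].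
case: (Kclosed y' z yK zA zK yz) => [|zS1|].
- by rewrite (negPf zR).
- have [u uH uz] := S1H z zS1 zH; rewrite (negPf zH) zA /=.
  by apply/existsP; exists u; rewrite uH.
- by rewrite (negPf zS').
Qed.

End Bags.

(** * Reducing the number of covering pieces to two *)

Section Reduction.
Variables (G T : sgraph) (W : T -> {set G}) (w r : nat).
Hypothesis tdW : is_tree_decomposition W.
Hypothesis Ww : forall t, #|W t| <= w.
Implicit Types (A C D H K M S : {set G}) (u v x y z : G).

(** A piece without a private neighbour of [C] could be dropped, leaving a cover by [m] pieces. *)
Lemma cov_uniq A C m : cov A C m.+1 -> ~ cov A C m ->
  exists Es : seq {set G}, [/\ uniq Es, size Es = m.+1,
    forall e, e \in Es -> [/\ connected_in e, e \subset A & [disjoint e & C]],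
    forall y z, y \in C -> z \in A -> z \notin C -> sedge y z ->
      exists2 e, e \in Es & z \in e
  & forall e, e \in Es -> exists y z, [/\ y \in C, z \in e, sedge y z &
      forall e', e' \in Es -> z \in e' -> e' = e]].
Proof.
move=> [Es0 sE [E1 E2]] ncov; pose Es := undup Es0.
have uE : uniq Es by apply: undup_uniq.
have E1' e : e \in Es -> [/\ connected_in e, e \subset A & [disjoint e & C]].
  by rewrite mem_undup; apply: E1.
have E2' y z : y \in C -> z \in A -> z \notin C -> sedge y z ->
    exists2 e, e \in Es & z \in e.
  by move=> yC zA zC /(E2 y z yC zA zC)[e eE ze]; exists e; rewrite ?mem_undup.
have sE' : size Es = m.+1.
  apply/eqP; rewrite eqn_leq (leq_trans (size_undup _) sE) /= ltnNge.
  by apply/negP=> sm; apply: ncov; exists Es.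
exists Es; split=> // e eE; apply: contrapT => npriv; apply: ncov.
exists (rem e Es); first by rewrite size_rem // sE'.
split=> [e' /mem_rem/E1' //|y z yC zA zC yz].
have [e0 e0E ze0] := E2' y z yC zA zC yz.
apply: contrapT => nex; apply: npriv; exists y, z.
have only e' : e' \in Es -> z \in e' -> e' = e.
  move=> e'E ze'; apply/eqP; apply: contrapT => /negP ne; apply: nex.
  by exists e'; rewrite // (rem_filter _ uE) mem_filter /= ne.
by split=> //; rewrite -(only e0).
Qed.

(** While at least three pieces are needed, one bag cuts off a minimal [H] meeting two of them.
    Outside [H], the set [H] fuses these pieces into one, so the count drops. Inside [H], the
    connected complement of a hull that meets at most one piece serves as a cover, together with
    that piece. *)
Lemma cov_reduce m A C : connected_in C -> C != set0 -> C \subset A ->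
  cov A C m -> split r C (m * w) (fun K => cov A K 2).
Proof.
elim: m A C => [|m IHm] A C cC C0 CA cov_m.
  by apply: split0 => //; apply: (covW _ cov_m).
have [cov_m'|ncov] := pselect (cov A C m).
  by apply: splitW (IHm _ _ cC C0 CA cov_m') => //; rewrite leq_mul2r leqnSn orbT.
have [m_le|m_gt] := leqP m.+1 2.
  by apply: splitW (split0 (Q := fun K => cov A K 2) r cC (covW m_le cov_m)).
have [Es [uE sE E1 E2 Epriv]] := cov_uniq cov_m ncov.
have [c cC'] := set0Pn _ C0.
have [e1 [e2 [e3 [Es' EE]]]] : exists e1 e2 e3 Es', Es = [:: e1, e2, e3 & Es'].
  by case: Es sE {uE E1 E2 Epriv} m_gt => [|e1 [|e2 [|e3 Es']]] //= [<-] // _;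
    exists e1, e2, e3, Es'.
have e1E : e1 \in Es by rewrite EE !inE eqxx.
have e2E : e2 \in Es by rewrite EE !inE eqxx orbT.
have e3E : e3 \in Es by rewrite EE !inE eqxx !orbT.
have [e12 e13 e23] : [/\ e2 != e1, e3 != e1 & e2 != e3].
  by move: uE; rewrite EE /= !inE !negb_or => /and3P[/and3P[]];
    rewrite ![e1 == _]eq_sym => -> -> _ /andP[-> _].
have dE z e : e \in Es -> z \in e -> z \notin C.
  by move=> /E1[_ _ de] ze; rewrite (disjointFr de ze).
(* The cut is made in [C] with its pieces only; this set is connected because every piece has a
   private neighbour of [C]. *)
pose A0 := C :|: [set z | has (fun e : {set G} => z \in e) Es].
have CA0 : C \subset A0 by apply: subsetUl.
have eA0 e : e \in Es -> e \subset A0.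
  move=> eE; apply/subsetP=> z ze; rewrite in_setU inE; apply/orP; right.
  by apply/hasP; exists e.
have A0A : A0 \subset A.
  rewrite subUset CA; apply/subsetP=> z; rewrite inE => /hasP[e /E1[_ /subsetP eA _]].
  exact: eA.
have cA0 : connected_in A0.
  apply: (connected_cover cC cC' CA0) => z /setUP[zC|].
    by exists C; split=> //; exists c.
  rewrite inE => /hasP[e eE ze]; exists (C :|: e).
  have [y [z' [yC z'e yz _]]] := Epriv e eE; have [ce _ _] := E1 e eE.
  split; [|by rewrite subUset CA0 eA0|by rewrite inE ze orbT|by exists c; rewrite // inE cC'].
  by apply: connectedU_adj => //; exists y, z'.
have [y1 [v0 [y1C v0e1 y1v0 v0_only]]] := Epriv e1 e1E.
have [ce1 e1A de1] := E1 e1 e1E.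
have v0A0 : v0 \in A0 by apply: (subsetP (eA0 _ e1E)).
have e10 : e1 != set0 by apply/set0Pn; exists v0.
have tdE : is_tree_decomposition (td_close W Es).
  by apply: td_closeP => // e /E1[].
case: (tdW) => _ cV _ _; have [y0 v0y] := cV v0.
have e1y0 : e1 \subset td_close W Es y0.
  apply/subsetP=> z ze; rewrite in_setU inE; apply/orP; right; apply/hasP; exists e1 => //.
  by rewrite ze (mem_nodes v0y v0e1).
have CAe : C \subset A0 :\: e1 by rewrite subsetD CA0 disjoint_sym.
have cAe := subsetP CAe _ cC'.
pose H0 := component (A0 :\: e1) c.
have CH0 : C \subset H0 by apply: component_max CAe cC' (mem_component _ _).
have H0Ae : H0 \subset A0 :\: e1 by apply: component_sub.
have meetH0 e : e \in Es -> e != e1 -> exists2 z, z \in e & z \in H0.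
  move=> eE ee1; have [y [z [yC ze yz only]]] := Epriv e eE; exists z => //.
  apply: (component_closed cAe (subsetP CH0 _ yC) _ yz).
  rewrite inE (subsetP (eA0 e eE)) // andbT; apply/negP=> /(only _ e1E) ee.
  by rewrite ee eqxx in ee1.
pose meets H e := exists2 z, z \in (e : {set G}) & z \in (H : {set G}).
pose Phi H := exists e e', [/\ e \in Es, e' \in Es, e != e', meets H e & meets H e'].
have [||||||H [S [y [[HH0 cH cAH [a [b [aE bE ab [a' a'a a'H] [b' b'b b'H]]]]] [SW SA NH SH part]]]]] :=
    cut_clean tdE cA0 v0A0 (H0 := H0) (y0 := y0) (Phi := Phi).
- exact: component_connected.
- exact: subset_trans H0Ae (subsetDl _ _).
- exact: (component_coconnected cA0 ce1 (eA0 _ e1E) e10 cAe).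
- by apply/negP=> /(subsetP H0Ae); rewrite inE v0e1.
- by exists e2, e3; split=> //; apply: meetH0.
- move=> u z uH /setDP[zA zH] uz; apply: (subsetP e1y0).
  apply: contrapT => /negP ze; case/negP: zH.
  by apply: component_closed uz; rewrite // inE ze.
have HA0 := subset_trans HH0 (subset_trans H0Ae (subsetDl _ _)).
rewrite mulSn; apply: (split_bind (Q := fun K => cov A K 2 \/ cov A K m)); last first.
  move=> K KC cK K0 [covK|covK].
    by apply: splitW (split0 (Q := fun K => cov A K 2) r cK covK).
  by apply: IHm => //; apply: subset_trans KC CA.
(* The bag was enlarged only by the pieces, which are disjoint from [C], so the part of [S] that is
   paid for has at most [w] vertices. *)
apply: (@split_small _ _ _ (S :&: C)); first exact: subsetIr.
  apply: (card_closed_bag Ww SW (subsetIl _ _)) => e eE.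
  rewrite disjoints_subset; apply/subsetP=> z ze; rewrite !inE negb_and.
  by rewrite (dE z e eE ze) orbT.
move=> x xCS; set K := component _ x.
have xK : x \in K by apply: mem_component.
have cK : connected_in K by apply: component_connected.
have KP z : z \in K -> [/\ z \in C, z \notin S & z \in A0].
  move/(subsetP (component_sub xCS))/setDP=> [zC]; rewrite in_setI zC andbT => zS.
  by split=> //; apply: (subsetP CA0).
have Kclosed y' z : y' \in K -> z \in C -> z \notin K -> sedge y' z -> z \in S.
  move=> yK zC zK yz; apply: contrapT => /negP nz; case/negP: zK.
  by apply: (component_closed xCS yK _ yz); rewrite !inE zC andbT (negPf nz).
have KH : (exists2 z, z \in K & z \in H) -> K \subset H.
  case=> z zK zH; apply/subsetP; apply: (connected_ind cK zK zH) => u v uK vK uH uv.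
  apply: contrapT => /negP vH; have [vC vS vA] := KP v vK.
  by case/negP: vS; apply: (NH u v) => //; apply/setDP.
have zEs y' z : y' \in K -> z \in A -> z \notin C -> sedge y' z ->
    exists e, [/\ e \in Es, z \in e & z \in A0].
  move=> yK zA zC yz; have [yC _ _] := KP _ yK.
  have [e eE ze] := E2 y' z yC zA zC yz.
  by exists e; split=> //; apply: (subsetP (eA0 e eE)).
have dKe e : e \in Es -> [disjoint e & K].
  move=> /E1[_ _ de]; apply: disjointWr de; apply/subsetP=> z zK; by case: (KP z zK).
case xH: (x \in H).
  left; have KHs : K \subset H by apply: KH; exists x.
  have KHS : K \subset H :\: S.
    by apply/subsetP=> z zK; rewrite inE (subsetP KHs) // andbT; case: (KP z zK).
  have xHS : x \in H :\: S := subsetP KHS _ xK.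
  have [D nD [cD v0D DA DHS CD]] := part x xHS.
  have KD : K \subset A0 :\: D.
    by apply: subset_trans CD; apply: component_max KHS xK (mem_component _ _).
  have dDK : [disjoint D & K].
    rewrite disjoint_sym disjoints_subset; apply: subset_trans KD _.
    by apply/subsetP=> z; rewrite !inE => /andP[].
  have DA' : D \subset A by apply: subset_trans DA A0A.
  have inD y' z : y' \in K -> z \in A -> z \notin K -> sedge y' z -> z \notin D ->
      exists2 e, e \in Es & z \in e /\ meets (A0 :\: D) e.
    move=> yK zA zK yz zD; have [zC|zC] := boolP (z \in C).
      have zAD : z \in A0 :\: D by rewrite inE zD (subsetP CA0).
      have := subsetP DHS z zAD.
      by rewrite inE (Kclosed y' z).
    have [e [eE ze zA0]] := zEs y' z yK zA zC yz.
    by exists e => //; split=> //; exists z; rewrite // inE zD.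
  case: (pselect (exists2 e, e \in Es & meets (A0 :\: D) e)) => [[e eE eD]|nm].
    exists [:: D; e] => //; split=> [e'|y' z yK zA zK yz].
      rewrite !inE => /orP[]/eqP->; first by split.
      by have [h1 h2 _] := E1 e eE; split=> //; apply: dKe.
    have [zD|zD] := boolP (z \in D); first by exists D; rewrite ?inE ?eqxx.
    have [e' e'E [ze' e'D]] := inD y' z yK zA zK yz zD.
    exists e; first by rewrite !inE eqxx orbT.
    have [<- //|ne] := eqVneq e' e.
    by case: nD; exists e', e.
  exists [:: D] => //; split=> [e'|y' z yK zA zK yz].
    by rewrite inE => /eqP->.
  exists D; first by rewrite mem_head.
  apply: contrapT => /negP zD.
  have [e' e'E [ze' e'D]] := inD y' z yK zA zK yz zD.
  by case: nm; exists e'.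
right.
have dKH z : z \in K -> z \notin H.
  by move=> zK; apply/negP=> zH; move: xH; rewrite (subsetP (KH _)) //; exists z.
pose N := [set z in A0 :\: H | [exists u in H, sedge u z]].
have NS z : z \in N -> z \in S.
  by rewrite inE => /andP[zAH /existsP[u /andP[uH uz]]]; apply: (NH u z).
pose bmeets (e : {set G}) := e :&: H != set0.
have bmeetsP (e : {set G}) z : z \in e -> z \in H -> bmeets e.
  by move=> ze zH; apply/set0Pn; exists z; rewrite inE ze.
(* [M] absorbs [H], its neighbours in [A0] and all pieces meeting [H]. At least two pieces disappear
   into it, so at most [m] remain. *)
pose M := H :|: N :|: [set z | has (fun e : {set G} => (z \in e) && bmeets e) Es].
have HM : H \subset M by rewrite /M -setUA subsetUl.
exists (M :: [seq e <- Es | ~~ bmeets e]).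
  have h1 : 2 <= count bmeets Es.
    rewrite -size_filter; apply: (@uniq_leq_size _ [:: a; b]); first by rewrite /= inE ab.
    move=> e; rewrite !inE mem_filter => /orP[]/eqP->; rewrite ?aE ?bE andbT.
      exact: bmeetsP a'a a'H.
    exact: bmeetsP b'b b'H.
  have := count_predC bmeets Es; rewrite sE /= size_filter => h2.
  by rewrite -(leq_add2l 1) !add1n -h2 -add2n leq_add2r.
split=> [e|y' z yK zA zK yz].
  rewrite inE => /predU1P[->|]; last first.
    by rewrite mem_filter => /andP[_ eE]; have [h1 h2 _] := E1 e eE; split=> //; apply: dKe.
  split.
  - apply: (connected_cover cH a'H HM) => z /setUP[/setUP[zH|zN]|].
    + by exists H; split=> //; exists a'.
    + have := zN; rewrite inE => /andP[_ /existsP[u /andP[uH uz]]].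
      exists [set u; z]; split; first exact: connected_edge.
      * by apply/subsetP=> d; rewrite !in_set2 => /orP[]/eqP->; rewrite !in_setU ?uH ?zN ?orbT.
      * by rewrite !inE eqxx orbT.
      * by exists u; rewrite // !inE eqxx.
    + rewrite inE => /hasP[e' e'E /andP[ze' me']]; have [ce' _ _] := E1 e' e'E.
      exists e'; split=> //.
        apply/subsetP=> d de'; rewrite in_setU inE; apply/orP; right.
        by apply/hasP; exists e'; rewrite ?de'.
      by have [d /setIP[d1 d2]] := set0Pn _ me'; exists d.
  - apply: subset_trans A0A; rewrite !subUset HA0 /=; apply/andP; split.
      by apply/subsetP=> d; rewrite inE => /andP[/setDP[]].
    apply/subsetP=> d; rewrite inE => /hasP[e' e'E /andP[de' _]].
    exact: (subsetP (eA0 e' e'E)).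
  - rewrite disjoint_sym disjoints_subset; apply/subsetP=> d dK.
    have [dC dS _] := KP d dK.
    rewrite inE !in_setU !negb_or dKH //=; apply/andP; split.
      by apply: contra dS; apply: NS.
    by rewrite inE; apply/hasPn=> e' e'E; rewrite (disjointFl (dKe e' e'E) dK).
have [zC|zC] := boolP (z \in C); last first.
  have [e [eE ze _]] := zEs y' z yK zA zC yz.
  have [me|me] := boolP (bmeets e); last first.
    by exists e; rewrite // inE mem_filter me eE orbT.
  exists M; rewrite ?mem_head // in_setU inE; apply/orP; right.
  by apply/hasP; exists e; rewrite // ze.
have zS : z \in S by apply: Kclosed yz.
have zH : z \notin H.
  apply/negP=> zH; have [_ yS yA0] := KP y' yK; case/negP: yS; apply: (NH z y' zH).
    by rewrite inE dKH.
  by rewrite sedge_sym.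
have [u uH uz] := SH z zS zH.
exists M; rewrite ?mem_head // !in_setU; apply/orP; left; apply/orP; right.
rewrite inE inE zH (subsetP CA0) //=; apply/existsP; exists u; by rewrite uH.
Qed.

End Reduction.

(** * Excluding an apex over an edgeless graph *)

Definition upclosed (G : sgraph) (Psi : {set G} -> Prop) :=
  forall B C : {set G}, B \subset C -> Psi B -> Psi C.

Definition rich_model (X G : sgraph) (Psi : {set G} -> Prop) (A : {set G})
    (B : X -> {set G}) : Prop :=
  is_model B /\ forall x, B x \subset A /\ Psi (B x).

Definition apex_model (Z G : sgraph) (Psi : {set G} -> Prop) (A D : {set G})
    (B : Z -> {set G}) : Prop :=
  [/\ rich_model Psi A B, D != set0 /\ connected_in D, D \subset A, Psi D
    & forall z, [disjoint D & B z] /\ adj D (B z)].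

(** The cost is linear in the bag size [w], and [f] is the growth in [r]. The cover by two pieces
    bounds the number of connected sets from which a later layer has to be separated. *)
Definition good_for (f : nat -> nat) (excl : forall G : sgraph, ({set G} -> Prop) -> {set G} -> Prop) :=
  exists c, forall (G T : sgraph) (W : T -> {set G}) w r (Psi : {set G} -> Prop) A,
    is_tree_decomposition W -> (forall t, #|W t| <= w) -> 1 < r ->
    upclosed Psi -> connected_in A -> A != set0 -> ~ excl G Psi A ->
    split r A (c * w * f r) (fun K => ~ Psi K /\ cov A K 2).

Definition good f (X : sgraph) := good_for f (fun G Psi A => exists B : X -> {set G}, rich_model Psi A B).

Definition good_apex f (Z : sgraph) :=
  good_for f (fun G Psi A => exists D (B : Z -> {set G}), apex_model Psi A D B).

(** * Splitting along a chain of small layers *)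

Section Chain.
Variables (G : sgraph) (r m N n J : nat) (A : {set G}) (Psi : {set G} -> Prop).
Variables U L : nat -> {set G}.
Let R i := U i :|: L i.
Hypotheses (RA : forall i, R i \subset A) (RU : forall i, R i \subset U i.+1).
Hypotheses (LU : forall i v, v \in L i -> v \notin U i) (Lm : forall i, #|L i| <= m).
Hypothesis Uclosed : forall i y z, y \in U i -> z \in A -> sedge y z -> z \in R i.
Hypotheses (RN : A \subset R N) (U0 : U 0 = set0).
Hypothesis PU : forall i x, x \in U i.+1 :\: R i ->
  ~ Psi (component (U i.+1 :\: R i) x) /\ cov A (component (U i.+1 :\: R i) x) n.
Hypotheses (rJ : r < 2 ^ J) (PsiS : upclosed Psi).
Implicit Types (K : {set G}) (u v x y z : G).

Let R_mono i j : i <= j -> R i \subset R j.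
Proof.
move/subnK=> <-; elim: (j - i) => // k; rewrite addSn => /subset_trans; apply.
exact: subset_trans (RU _) (subsetUl _ _).
Qed.

Let lvl v := find (fun i => v \in R i) (iota 0 N.+1).

Let lvlP v i : v \in A -> (lvl v <= i) = (v \in R i).
Proof.
move=> vA.
have hv : has (fun i => v \in R i) (iota 0 N.+1).
  by apply/hasP; exists N; [rewrite mem_iota add0n ltnSn|apply: (subsetP RN)].
have lt : lvl v < N.+1 by have := hv; rewrite has_find size_iota.
apply/idP/idP => [/R_mono/subsetP|vi].
  by apply; have := nth_find 0 hv; rewrite nth_iota.
rewrite leqNgt; apply/negP=> il.
have := before_find 0 il; rewrite nth_iota ?vi //.
exact: ltn_trans lt.
Qed.

Let lvlL v i : v \in L i -> lvl v = i.
Proof.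
move=> vL; have vR : v \in R i by rewrite inE vL orbT.
have vA := subsetP (RA i) _ vR.
apply/eqP; rewrite eqn_leq lvlP // vR /= leqNgt; apply/negP.
case: i vL {vR} => // i vL; rewrite ltnS lvlP // => vR.
by have := LU vL; rewrite (subsetP (RU i)).
Qed.

Let lvl_edge y z : y \in A -> z \in A -> sedge y z -> lvl z <= (lvl y).+1.
Proof.
move=> yA zA yz; rewrite lvlP //; apply: Uclosed zA yz.
by apply: (subsetP (RU _)); rewrite -lvlP.
Qed.

Let lvl_path u p : path (@sedge G) u p -> {subset u :: p <= A} ->
  lvl (last u p) <= lvl u + size p /\ lvl u <= lvl (last u p) + size p.
Proof.
elim: p u => [|z p IHp] u /=; first by rewrite addn0.
case/andP=> uz zp sA.
have [|h1 h2] := IHp z zp; first by move=> a ap; apply: sA; rewrite inE ap orbT.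
have uA : u \in A by apply: sA; rewrite mem_head.
have zA : z \in A by apply: sA; rewrite !inE eqxx orbT.
have h3 := lvl_edge uA zA uz; rewrite sedge_sym in uz.
have h4 := lvl_edge zA uA uz; split.
  by apply: leq_trans h1 _; rewrite addnS -addSn leq_add2r.
by apply: leq_trans h4 _; rewrite addnS ltnS.
Qed.

(** Edges of [A] leave [U i] only into [L i], so a connected set avoiding [L i] stays on one
    side. *)
Let sep i K : connected_in K -> K \subset A -> (forall v, v \in K -> v \notin L i) ->
  K \subset U i \/ [disjoint K & R i].
Proof.
move=> cK KA KL; case: (boolP [disjoint K & R i]) => [|/pred0Pn[v /andP[/= vK vR]]]; first by right.
have inU u : u \in K -> u \in R i -> u \in U i.
  by move=> uK; rewrite inE (negPf (KL u uK)) orbF.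
left; apply/subsetP; apply: (connected_ind cK vK (inU v vK vR)) => a b aK bK aU ab.
by apply: inU => //; apply: Uclosed aU _ ab; apply: (subsetP KA).
Qed.

Let between j K : Prop :=
  (exists2 a, [disjoint K & R a] & K \subset U (a + 2 ^ j)) /\
  (forall y z, y \in K -> z \in A -> z \notin K -> sedge y z -> z \in L (lvl z)).

(** Removing the middle layer, of at most [m] vertices, halves the gap. *)
Let halve j K : K \subset A -> connected_in K -> between j.+1 K -> split r K m (between j).
Proof.
move=> KA cK [[a Ka Kb] Kc]; apply: (@split_small _ _ _ (K :&: L (a + 2 ^ j))).
- exact: subsetIl.
- exact: leq_trans (subset_leq_card (subsetIr _ _)) (Lm _).
move=> x xKS; set K' := component _ x.
have K'S : K' \subset K :\: (K :&: L (a + 2 ^ j)) := component_sub xKS.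
have K'K := subset_trans K'S (subsetDl _ _).
split.
  case: (@sep (a + 2 ^ j) K') => [||v /(subsetP K'S)|K'U|K'R].
  - exact: component_connected.
  - exact: subset_trans K'K KA.
  - by rewrite !inE => /andP[+ vK]; rewrite vK.
  - by exists a => //; apply: disjointWl K'K Ka.
  - exists (a + 2 ^ j) => //; rewrite -addnA addnn -mul2n -expnS.
    exact: subset_trans K'K Kb.
move=> y z yK' zA zK' yz; have [zK|zK] := boolP (z \in K); last first.
  by apply: Kc zA zK yz; apply: (subsetP K'K).
have [zL|zL] := boolP (z \in L (a + 2 ^ j)); first by rewrite (lvlL zL).
by case/negP: zK'; apply: (component_closed xKS yK' _ yz); rewrite !inE zK andbT.
Qed.

Let halve_all j K : K \subset A -> connected_in K -> between j K ->
  split r K (j * m) (between 0).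
Proof.
elim: j K => [|j IHj] K KA cK bK; first by apply: split0.
rewrite mulSn; apply: split_bind (halve KA cK bK) _ => K' K'K cK' _.
by apply: IHj => //; apply: subset_trans KA.
Qed.

(** The removed levels are the multiples of [2 ^ J]. Levels change by at most one along an edge and
    [r < 2 ^ J], so a path with at most [r] edges reaches only the two multiples that enclose its
    starting level; a constant rank is enough. *)
Let coarse : split r A (m + m) (between J).
Proof.
pose S := [set v in A | (2 ^ J %| lvl v) && (v \in L (lvl v))].
have M0 : 0 < 2 ^ J by rewrite expn_gt0.
exists S, (fun=> 0); split.
- by apply/subsetP=> v; rewrite inE => /andP[].
- move=> u uA; pose a := lvl u %/ 2 ^ J.
  apply: leq_trans (leq_add (Lm (a * 2 ^ J)) (Lm (a.+1 * 2 ^ J))).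
  apply: leq_trans _ (leq_card_setU _ _); apply/subset_leq_card/subsetP=> v.
  case/wrP=> [vS [p [up lp pA sp _]]]; have := lvl_path up pA; rewrite lp.
  move: vS; rewrite inE => /and3P[vA /dvdnP[b eb] vL] [h1 h2].
  have hu := divn_eq (lvl u) (2 ^ J); have := ltn_pmod (lvl u) M0.
  rewrite -/a in hu; rewrite eb in vL h1 h2; rewrite in_setU => hm.
  have ba : b < a.+2.
    by rewrite -(ltn_pmul2r M0) !mulSn; lia.
  have ab : a < b.+1.
    by rewrite -(ltn_pmul2r M0) mulSn; lia.
  move: ba; rewrite ltnS leq_eqVlt => /orP[/eqP<-|ba]; first by rewrite vL orbT.
  by have -> : a = b; [apply/eqP; rewrite eqn_leq -ltnS ab -ltnS ba|rewrite vL].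
move=> x xAS; set K := component _ x.
have KS : K \subset A :\: S := component_sub xAS.
have KA := subset_trans KS (subsetDl _ _).
have cK : connected_in K by apply: component_connected.
have xK : x \in K by apply: mem_component.
have xA := subsetP KA _ xK.
have KL b v : v \in K -> v \notin L (b * 2 ^ J).
  move=> vK; apply/negP=> vL; have := subsetP KS _ vK.
  by rewrite !inE (lvlL vL) vL dvdn_mull // (subsetP KA).
(* Level [0] is [L 0], which lies in [S]; hence the predecessor of the level of [x] taken below is
   harmless. *)
have x0 : 0 < lvl x.
  rewrite lt0n; apply/eqP=> e; have := KL 0 x xK; have : x \in R 0 by rewrite -lvlP // e.
  by rewrite mul0n inE U0 inE /= => ->.
split.
  pose a := (lvl x).-1 %/ 2 ^ J; exists (a * 2 ^ J).
    case: (sep cK KA (KL a)) => // /subsetP/(_ x xK) xU.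
    have : x \in R (a * 2 ^ J) by rewrite inE xU.
    rewrite -lvlP // => h; have := leq_trans h (leq_trunc_div _ _).
    by rewrite -ltnS prednK // ltnn.
  rewrite -{2}[2 ^ J]mul1n -mulnDl addn1.
  case: (sep cK KA (KL a.+1)) => // /disjointFr/(_ xK).
  by rewrite -lvlP // -[lvl x]prednK // -(ltn_divLR _ _ M0) ltnS leqnn.
move=> y z yK zA zK yz; have [|zS] := boolP (z \in S); first by rewrite inE => /and3P[].
by case/negP: zK; apply: (component_closed xAS yK _ yz); rewrite in_setD zS.
Qed.

(** A gap of width one is a whole component of [U a.+1 :\: R a]: an edge extending it would end in
    [L a.+1], which is disjoint from [U a.+1]. *)
Let fine K : K \subset A -> connected_in K -> K != set0 -> between 0 K ->
  ~ Psi K /\ cov A K n.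
Proof.
move=> KA cK /set0Pn[x xK] [[a Ka Kb] Kc]; rewrite expn0 addn1 in Kb.
have KU : K \subset U a.+1 :\: R a by rewrite subsetD Kb.
have xU := subsetP KU _ xK.
suff -> : K = component (U a.+1 :\: R a) x by apply: PU.
apply/eqP; rewrite eqEsubset (component_max cK KU xK (mem_component _ _)) /=.
apply/subsetP; apply: (connected_ind (@component_connected _ _ _) (mem_component _ _) xK).
move=> u v uC vC uK uv; apply: contrapT => /negP vK.
have /setDP[vU vR] := subsetP (component_sub xU) _ vC.
have vA : v \in A by apply: (subsetP (RA a.+1)); rewrite inE vU.
have vL := Kc u v uK vA vK uv.
have : lvl v <= a.+1 by rewrite lvlP // inE vU.
rewrite leq_eqVlt ltnS lvlP // (negPf vR) orbF => /eqP e.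
by rewrite e in vL; have := LU vL; rewrite vU.
Qed.

(** Two layers are paid for the coarse splitting and one for each of the [J] halvings. *)
Lemma chain_split : split r A ((J.+2) * m) (fun K => ~ Psi K /\ cov A K n).
Proof.
rewrite !mulSn addnA; apply: split_bind coarse _ => K KA cK _ bK.
apply: splitW (halve_all KA cK bK) => // K' K'K cK' K'0.
by apply: fine => //; apply: subset_trans KA.
Qed.

End Chain.

(** The successor ensures [r < 2 ^ lg r] and [1 <= lg r]. *)
Definition lg (r : nat) := (trunc_log 2 r).+1.

Lemma bag_gt0 (G T : sgraph) (W : T -> {set G}) w (A : {set G}) :
  is_tree_decomposition W -> (forall t, #|W t| <= w) -> A != set0 -> 0 < w.
Proof.
case=> _ cV _ _ Ww /set0Pn[x _]; have [t xt] := cV x.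
by apply: leq_trans (Ww t); apply/card_gt0P; exists x.
Qed.

Lemma split_reduce (G T : sgraph) (W : T -> {set G}) w r (Psi : {set G} -> Prop) A k n :
  is_tree_decomposition W -> (forall t, #|W t| <= w) -> upclosed Psi ->
  split r A k (fun K => ~ Psi K /\ cov A K n) ->
  split r A (k + n * w) (fun K => ~ Psi K /\ cov A K 2).
Proof.
move=> tdW Ww PsiS sA; apply: split_bind sA _ => K KA cK K0 [nP cK'].
apply: splitW (cov_reduce r tdW Ww cK K0 KA cK') => // K' K'K _ _ cov'.
by split=> // /(PsiS _ _ K'K).
Qed.

(** If [#|Z|.+1] disjoint sets with [Psi] touched the region [R] grown so far, one of them joined to
    [R] would be an apex and the others a model of the edgeless [Z]. So a hitting set of size at
    most [#|Z| * w] exists and yields the next layer; the regions grow until they fill [A]. *)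
Lemma star_chain (G T : sgraph) (W : T -> {set G}) w (Psi : {set G} -> Prop) A v0
    (Z : sgraph) : (forall x y : Z, ~~ sedge x y) ->
  is_tree_decomposition W -> (forall t, #|W t| <= w) -> upclosed Psi ->
  connected_in A -> v0 \in A ->
  ~ (exists D (B : Z -> {set G}), apex_model Psi A D B) ->
  exists U L : nat -> {set G}, let R i := U i :|: L i in
  [/\ forall i, R i \subset A, forall i, R i \subset U i.+1,
    forall i v, v \in L i -> v \notin U i,
    forall i, #|L i| <= #|Z|.+1 * w
  & [/\ forall i y z, y \in U i -> z \in A -> sedge y z -> z \in R i,
    A \subset R #|A|, U 0 = set0
  & forall i x, x \in U i.+1 :\: R i ->
    ~ Psi (component (U i.+1 :\: R i) x) /\
    cov A (component (U i.+1 :\: R i) x) #|Z|.+1]].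
Proof.
move=> Zedge tdW Ww PsiS cA v0A nmod.
pose valid (R : {set G}) := [/\ connected_in R, R \subset A & v0 \in R].
pose next (R : {set G}) (p : {set G} * {set G}) := let: (U, L) := p in
  [/\ R \subset U, valid (U :|: L), forall v, v \in L -> v \notin U, #|L| <= #|Z| * w
  & (forall y z, y \in U -> z \in A -> sedge y z -> z \in U :|: L) /\
    forall x, x \in U :\: R -> ~ Psi (component (U :\: R) x) /\
      cov A (component (U :\: R) x) #|Z|.+1].
have /choice[g gP] : forall R, exists p, valid R -> next R p.
  move=> R; case: (pselect (valid R)) => [[cR RA v0R]|nv]; last by exists (set0, set0).
  pose PsiR (B : {set G}) := Psi B /\ adj B R.
  have PsiRS : upclosed PsiR.
    move=> B C BC [PB aB]; split; first exact: PsiS PB.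
    exact: adjS BC (subxx _) aB.
  have R0 : R != set0 by apply/set0Pn; exists v0.
  have npk : ~ packing PsiR #|Z|.+1 (A :\: R).
    case=> f [fP fd]; apply: nmod.
    have [cf0 f0A f00 [Pf0 af0]] := fP 0 isT.
    pose B (z : Z) := f (enum_rank z).+1.
    have BP z : [/\ connected_in (B z), B z \subset A :\: R, B z != set0 & PsiR (B z)].
      by apply: fP; rewrite ltnS.
    exists (R :|: f 0), B; split.
    - split=> [|z]; last first.
        have [_ h2 _ [h4 _]] := BP z; split=> //.
        exact: subset_trans h2 (subsetDl _ _).
      split=> [z|z|x y xy|x y xy]; [by case: (BP z)|by case: (BP z)| |].
        have : (enum_rank x : nat) != enum_rank y by rewrite (inj_eq val_inj) (inj_eq enum_rank_inj).
        rewrite neq_ltn => /orP[] lt.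
          by apply: fd; rewrite !ltnS.
        by rewrite disjoint_sym; apply: fd; rewrite !ltnS.
      by have := Zedge x y; rewrite xy.
    - split; first by apply/set0Pn; exists v0; rewrite inE v0R.
      by apply: connectedU_adj cR cf0 _; apply: adjC.
    - by rewrite subUset RA; apply: subset_trans f0A (subsetDl _ _).
    - by apply: PsiS Pf0; apply: subsetUr.
    move=> z; have [_ h2 _ [_ h4]] := BP z; split; last first.
      by apply: adjC; apply: adjS h4 => //; apply: subsetUl.
    rewrite disjoints_subset subUset -!disjoints_subset; apply/andP; split.
      rewrite disjoint_sym disjoints_subset; apply: subset_trans h2 _.
      by apply/subsetP=> a; rewrite !inE => /andP[].
    by apply: fd; rewrite ?ltnS.
  have [S [SA Sw Spart]] := hitting_set tdW Ww PsiRS cA cR RA v0R npk.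
  have SR v : v \in S -> v \notin R by move/(subsetP SA); rewrite inE => /andP[].
  have v0AS : v0 \in A :\: S by rewrite inE v0A andbT; apply: contraL v0R; apply: SR.
  (* The next region is the component around [R], and only the hitting vertices adjacent to it form
     the next layer. *)
  pose U := component (A :\: S) v0.
  have UAS : U \subset A :\: S := component_sub v0AS.
  have UA := subset_trans UAS (subsetDl _ _).
  have cU : connected_in U by apply: component_connected.
  have v0U : v0 \in U by apply: mem_component.
  have RAS : R \subset A :\: S.
    apply/subsetP=> v vR; rewrite inE (subsetP RA) // andbT.
    by apply: contraL vR; apply: SR.
  have RU : R \subset U by apply: component_max RAS v0R v0U.
  pose L := [set z in S | [exists y in U, sedge y z]].
  have LA : L \subset A.
    apply/subsetP=> z; rewrite inE => /andP[/(subsetP SA) + _].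
    by case/setDP.
  have LS : L \subset S by apply/subsetP=> z; rewrite inE => /andP[].
  have Uclosed y z : y \in U -> z \in A -> sedge y z -> z \in U :|: L.
    move=> yU zA yz; rewrite in_setU; apply/orP; have [zS|zS] := boolP (z \in S).
      by right; rewrite inE zS; apply/existsP; exists y; rewrite yU.
    by left; apply: (component_closed v0AS yU _ yz); rewrite inE zS.
  exists (U, L) => _; split=> //.
  - split; last by rewrite inE v0U.
      apply: (connected_cover cU v0U (subsetUl _ _)) => z /setUP[zU|zL].
        by exists U; split=> //; [apply: subsetUl|exists v0].
      have := zL; rewrite inE => /andP[_ /existsP[y /andP[yU yz]]].
      exists [set y; z]; split; first exact: connected_edge.
      + by apply/subsetP=> b; rewrite !in_set2 => /orP[]/eqP->; rewrite in_setU ?yU ?zL ?orbT.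
      + by rewrite !inE eqxx orbT.
      + by exists y; rewrite // !inE eqxx.
    by rewrite subUset UA LA.
  - move=> v /(subsetP LS) vS; apply/negP=> /(subsetP UAS).
    by rewrite inE vS.
  - exact: leq_trans (subset_leq_card LS) Sw.
  split=> // x xUR; set K := component _ x.
  have KU : K \subset U :\: R := component_sub xUR.
  have KARS : K \subset A :\: R :\: S.
    apply/subsetP=> z /(subsetP KU)/setDP[/(subsetP UAS)/setDP[zA zS] zR].
    by rewrite !in_setD zA zS zR.
  have xK : x \in K by apply: mem_component.
  have cK : connected_in K by apply: component_connected.
  have xP := subsetP KARS _ xK.
  have [nP cK'] := Spart x xP; set C := component _ x in nP cK'.
  have KC : K \subset C by apply: component_max KARS xK (mem_component _ _).
  have cC : connected_in C by apply: component_connected.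
  have C1 : C \subset A :\: R :\: S := component_sub xP.
  have xU : x \in U by case/setDP: xUR.
  have CU : C \subset U.
    apply: component_max cC _ (mem_component _ _) xU.
    by apply: subset_trans C1 _; apply: setSD; apply: subsetDl.
  have -> : K = C.
    apply/eqP; rewrite eqEsubset KC; apply: component_max cC _ (mem_component _ _) xK.
    by rewrite subsetD CU disjoints_subset; apply: subset_trans C1 _;
      apply/subsetP=> z; rewrite !inE => /andP[_ /andP[]].
  (* A component of [U :\: R] touches [R], so [Psi] alone already contradicts the hitting
     property. *)
  split=> // PC; apply: nP; split=> //.
  by apply: adjS KC (subxx _) _; apply: component_adj.
pose seqR := fix seqR i := if i is i'.+1 then (g (seqR i')).1 :|: (g (seqR i')).2 else [set v0].
pose U i := if i is i'.+1 then (g (seqR i')).1 else set0.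
pose L i := if i is i'.+1 then (g (seqR i')).2 else [set v0].
have RE i : U i :|: L i = seqR i by case: i => //=; rewrite set0U.
have vR i : valid (seqR i).
  elim: i => [|i vRi] /=; first by split; [apply: connected1|rewrite sub1set|rewrite inE].
  by have := gP _ vRi; case: (g _) => Ui Li [].
have st i : next (seqR i) (U i.+1, L i.+1).
  by have := gP _ (vR i); rewrite /U /L; case: (g _).
have RA i : seqR i \subset A by case: (vR i).
have RU i : seqR i \subset U i.+1 by case: (st i).
have w0 : 0 < w by apply: (@bag_gt0 _ _ _ _ A tdW Ww); apply/set0Pn; exists v0.
exists U, L => /=; split=> [i|i|i v|i|].
- by rewrite RE.
- by rewrite RE; apply: RU.
- by case: i => [|i]; [rewrite in_set0|case: (st i) => _ _ + _ _; apply].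
(* The first layer has one vertex even if [Z] is empty, hence the successor in the bound. *)
- case: i => [|i]; first by rewrite cards1 muln_gt0.
  by case: (st i) => _ _ _ h _; apply: leq_trans h _; rewrite leq_mul2r leqnSn orbT.
split=> // [i y z||i x].
- by rewrite RE; case: i => [|i]; [rewrite in_set0|case: (st i) => _ _ _ _ [+ _]; rewrite RE; apply].
- rewrite RE; have H i : (i < #|seqR i|) || (A \subset seqR i).
    elim: i => [|i]; first by rewrite /= cards1.
    have sub : seqR i \subset seqR i.+1 by rewrite -(RE i.+1); apply: subset_trans (RU i) (subsetUl _ _).
    case/orP=> [lt|AR]; last by rewrite (subset_trans AR sub) orbT.
    have [|AR] := boolP (A \subset seqR i.+1); rewrite ?orbT // orbF.
    have {}AR : ~~ (A \subset seqR i) by apply: contra AR => /subset_trans; apply.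
    have [z zA zR] := subsetPn AR; case: (vR i) => cR _ v0R.
    have [a [b [aA aR bA bR ab]]] := connected_boundary cA v0A v0R zA zR.
    apply: leq_ltn_trans lt _; apply: proper_card; apply/properP; split=> //.
    exists b => //; rewrite -(RE i.+1); case: (st i) => _ _ _ _ [cl _].
    by apply: cl ab => //; apply: (subsetP (RU i)).
  have /orP[|//] := H #|A|.
  by rewrite ltnNge (subset_leq_card (RA _)).
- by rewrite RE; case: (st i) => _ _ _ _ [_]; apply.
Qed.

Lemma good_star (Z : sgraph) : (forall x y : Z, ~~ sedge x y) -> good_apex lg Z.
Proof.
move=> Zedge; exists (4 * #|Z|.+1) => G T W w r Psi A tdW Ww r1 PsiS cA A0 nmod.
have [v0 v0A] := set0Pn _ A0.
have [U [L [c1 c2 c3 c4 [c5 c6 c7 c8]]]] := star_chain Zedge tdW Ww PsiS cA v0A nmod.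
have rJ : r < 2 ^ lg r by apply: trunc_log_ltn.
have sA := chain_split c1 c2 c3 c4 c5 c6 c7 c8 rJ.
(* The chain costs [lg r + 2] times [#|Z|.+1 * w] and the reduction to two pieces once more;
   [lg r + 3 <= 4 * lg r] gives the factor 4. *)
apply: splitW (split_reduce tdW Ww PsiS sA) => //.
rewrite -mulSnr -[4 * _ * w]mulnA mulnAC !mulnA; do 2 apply: leq_mul => //.
by rewrite /lg; lia.
Qed.

(** * Excluding an apex *)

Section Layers.
Variables (G T : sgraph) (W : T -> {set G}) (w r c h0 : nat).
Variables (Psi : {set G} -> Prop) (A : {set G}) (Z Zp : sgraph) (i : Z -> Zp) (z0 : Zp).
Hypotheses (tdW : is_tree_decomposition W) (Ww : forall t, #|W t| <= w).
Hypotheses (PsiS : upclosed Psi) (cA : connected_in A).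
Hypotheses (inj_i : injective i) (hom_i : forall x y, sedge x y -> sedge (i x) (i y)).
Hypothesis (iz0 : forall z, i z != z0).
Hypothesis nmod : ~ exists D (B : Z -> {set G}), apex_model Psi A D B.
Hypothesis good_Zp : forall (Psi' : {set G} -> Prop) A', upclosed Psi' ->
  connected_in A' -> A' != set0 ->
  ~ (exists B : Zp -> {set G}, rich_model Psi' A' B) ->
  split r A' h0 (fun K => ~ Psi' K /\ cov A' K 2).
Implicit Types (C K e S : {set G}) (u v x y z : G).

(* If [K] had a model of [Zp] all of whose branch sets touch [e], then [e]
   together with the branch set of [z0] would be an apex for the rest. *)
Let split_sides (Es : seq {set G}) C : C \subset A -> connected_in C -> C != set0 ->
  (forall e, e \in Es -> [/\ connected_in e, e \subset A & [disjoint e & C]]) ->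
  split r C (size Es * h0)
    (fun K => cov C K (2 * size Es) /\ forall e, e \in Es -> ~ Psi K \/ ~ adj K e).
Proof.
move=> CA cC C0; elim: Es => [|e Es IH] EP /=.
  by apply: split0 => //; split=> [|e]; [apply: cov_self|rewrite in_nil].
have [ce eA deC] := EP e (mem_head _ _).
rewrite mulSn addnC; apply: split_bind (IH _) _.
  by move=> e' e'E; apply: EP; rewrite inE e'E orbT.
move=> K KC cK K0 [covK sepK]; pose Pe B := Psi B /\ adj B e.
have deK : [disjoint e & K] := disjointWr KC deC.
have PeS : upclosed Pe.
  by move=> B B' BB [PB aB]; split; [apply: PsiS PB|apply: adjS aB].
have nK : ~ exists B : Zp -> {set G}, rich_model Pe K B.
  case=> B [[B1 B2 B3 B4] BK]; apply: nmod.
  exists (e :|: B z0), (B \o i); split.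
  - split; first split=> [x|x|x y xy|x y xy] /=.
    + exact: B1.
    + exact: B2.
    + by apply: B3; rewrite (inj_eq inj_i).
    + by apply: B4; apply: hom_i.
    by move=> x; have [xK [Px _]] := BK (i x); split=> //; apply: subset_trans xK (subset_trans KC CA).
  - split.
      have [b bB] := set0Pn _ (B1 z0).
      by apply/set0Pn; exists b; rewrite inE bB orbT.
    apply: connectedU_adj ce (B2 z0) _; apply: adjC.
    by have [_ []] := BK z0.
  - by rewrite subUset eA; have [zK _] := BK z0; apply: subset_trans zK (subset_trans KC CA).
  - by have [_ [Pz _]] := BK z0; apply: PsiS Pz; apply: subsetUr.
  move=> x /=; have [xK [_ ax]] := BK (i x); split; last first.
    by apply: adjC; apply: adjS ax => //; apply: subsetUl.
  rewrite disjoints_subset subUset -!disjoints_subset B3 1?eq_sym ?iz0 // andbT.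
  exact: disjointWr xK deK.
apply: splitW (good_Zp PeS cK K0 nK) => // K' K'K _ _ [nP cov'].
split; first by rewrite mulnS addnC; apply: cov_trans K'K KC covK cov'.
move=> e'; rewrite inE => /predU1P[->|e'E].
  by case: (pselect (Psi K')) => [PK|]; [right=> aK; apply: nP|left].
case: (sepK e' e'E) => nK'; [left=> PK|right=> aK]; apply: nK'.
  exact: PsiS PK.
exact: adjS aK.
Qed.

(** The cost of one layer: [h0] for each of two covering pieces, then [6 * w] to bring six pieces
    back to two. *)
Let h := 2 * h0 + 6 * w.

Let inner C K := forall y z, y \in K -> z \in A -> sedge y z -> z \in C.

(** After separation from the pieces covering [C], a component that still has [Psi] touches none of
    them, so its neighbours all lie in [C]. *)
Let split_layer C : C \subset A -> connected_in C -> C != set0 -> cov A C 2 ->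
  split r C h (fun K => cov A K 2 /\ (~ Psi K \/ inner C K)).
Proof.
move=> CA cC C0 [Es sE [E1 E2]].
have CC : cov A C 2 by exists Es.
apply: split_bind (splitW _ _ (split_sides CA cC C0 E1)) _.
- by rewrite leq_mul2r sE orbT.
- by move=> K _ _ _; apply.
move=> K KC cK K0 [covK sepK].
have cov6 : cov A K 6.
  apply: covW (cov_trans KC CA CC covK).
  by rewrite -[6]/(2 + 2 * 2) leq_add2l leq_mul2l sE.
apply: splitW (cov_reduce r tdW Ww cK K0 (subset_trans KC CA) cov6) => // K' K'K _ _ cov'.
split=> //; case: (pselect (Psi K')) => [PK'|]; [right|by left].
move=> y z yK' zA yz; apply: contrapT => /negP zC.
have yK := subsetP K'K _ yK'.
have [e eE ze] := E2 y z (subsetP KC _ yK) zA zC yz.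
case: (sepK e eE); first by apply; apply: PsiS PK'.
by apply; exists y, z.
Qed.

(* [N] bounds the number of layers that are visible from [u]; a path that leaves
   [C] has to cross all of them, so that never more than [r.+1] count. *)
Let budget C S rho u := exists N, [/\ N <= r.+1, #|wr r C S rho u| <= N * h
  & forall p, path (@sedge G) u p -> {subset u :: p <= A} -> last u p \notin C ->
      N <= size p].

(** Recursion on the size of [C]: one layer is split off, and only components that still have [Psi]
    are layered further. The edge leaving such a component stays in [C], so leaving [C] takes one
    edge more, and [N] may grow by one. *)
Let layered n C : #|C| <= n -> C \subset A -> connected_in C -> C != set0 ->
  ~~ (A \subset C) -> cov A C 2 ->
  exists S rho, [/\ S \subset C, forall u, u \in C -> budget C S rho u
    & forall x, x \in C :\: S -> ~ Psi (component (C :\: S) x) /\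
        cov A (component (C :\: S) x) 2].
Proof.
elim: n C => [|n IHn] C.
  by rewrite leqn0 cards_eq0 => /eqP-> _ _; rewrite eqxx.
move=> Cn CA cC C0 AC covC.
have [S1 [rho1 [S1C S1h S1P]]] := split_layer CA cC C0 covC.
pose props K (p : {set G} * (G -> nat)) := [/\ p.1 \subset K,
  forall u, u \in K -> #|wr r K p.1 p.2 u| = 0 \/ (inner C K /\ budget K p.1 p.2 u)
  & forall x, x \in K :\: p.1 -> ~ Psi (component (K :\: p.1) x) /\
        cov A (component (K :\: p.1) x) 2].
have [f fP] : exists f : {set G} -> {set G} * (G -> nat), forall K,
    [/\ K \subset C, connected_in K, K != set0 & cov A K 2 /\ (~ Psi K \/ inner C K)] ->
    props K (f K).
  suff /choice[f fP] : forall K, exists p,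
    [/\ K \subset C, connected_in K, K != set0 & cov A K 2 /\ (~ Psi K \/ inner C K)] ->
    props K p by exists f.
  move=> K; case: (pselect (Psi K)) => [PK|nP]; last first.
    exists (set0, fun=> 0) => -[_ cK _ [covK _]]; split=> /= [|u uK|x].
    - exact: sub0set.
    - by left; apply/eqP; rewrite -leqn0 -(cards0 G) subset_leq_card // wr_sub.
    - by rewrite setD0 => xK; rewrite component_id.
  case: (pselect [/\ K \subset C, connected_in K, K != set0 & cov A K 2 /\ inner C K]); last first.
    by move=> nK; exists (set0, fun=> 0) => -[h1 h2 h3 [h4 [//|h5]]]; case: nK.
  case=> KC cK K0 [covK iK].
  (* The neighbours of [K] stay in [C]; if [K] were [C], no edge of the connected set [A] would lead
     out of [C]. *)
  have KpC : K \proper C.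
    rewrite properE KC; apply/negP=> CK; case/negP: AC.
    have eKC : K = C by apply/eqP; rewrite eqEsubset KC.
    have [k kK] := set0Pn _ K0; apply/subsetP=> a aA; apply: contrapT => /negP aC.
    have kC := subsetP KC _ kK.
    have [u [v [uA uC vA vC uv]]] := connected_boundary cA (subsetP CA _ kC) kC aA aC.
    by case/negP: vC; apply: (iK u); rewrite ?eKC.
  have Kn : #|K| <= n by rewrite -ltnS; apply: leq_trans (proper_card KpC) Cn.
  have AK : ~~ (A \subset K) by apply: contra AC => /subset_trans; apply.
  have [S [rho [SK Sb SP]]] := IHn K Kn (subset_trans KC CA) cK K0 AK covK.
  by exists (S, rho) => _; split=> //= u uK; right; split=> //; apply: Sb.
pose part x := component (C :\: S1) x.
have partP x : x \in C :\: S1 -> props (part x) (f (part x)).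
  move=> xCS; apply: fP; split; last exact: S1P.
  - exact: subset_trans (component_sub xCS) (subsetDl _ _).
  - exact: component_connected.
  - by apply/set0Pn; exists x; apply: mem_component.
pose Sf K := (f K).1; pose rf K := (f K).2.
exists (glue_set C S1 Sf), (glue_rank C S1 rho1 rf); split.
- exact: glue_sub.
- move=> u uC; have := @glue_wr G r C S1 rho1 Sf rf u uC; case: ifP => u1 sub.
    exists 1; split=> //.
      rewrite mul1n; apply: leq_trans (S1h u uC).
      by apply: subset_leq_card; rewrite setU0 in sub.
    by case=> [|//] /= _ _; rewrite uC.
  have uCS : u \in C :\: S1 by rewrite inE u1.
  have up : u \in part u by apply: mem_component.
  have pCS : part u \subset C :\: S1 := component_sub uCS.
  have pC := subset_trans pCS (subsetDl _ _).
  have card_le := leq_trans (subset_leq_card sub) (leq_card_setU _ _).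
  have [_ /(_ u up)[w0|[ip [N [Nr Nw Np]]]] _] := partP u uCS.
    exists 1; split=> //.
      by rewrite mul1n; apply: leq_trans card_le _; rewrite w0 addn0; apply: S1h.
    by case=> [|//] /= _ _; rewrite uC.
  (* If [r.+1] layers already count inside the component, a path with at most [r] edges cannot leave
     it, so the new layer is invisible from [u]. *)
  have [eN|ltN] := eqVneq N r.+1.
    exists r.+1; split=> //; last first.
      rewrite -eN => p pp pA pl; apply: Np => //.
      by apply: contra pl; apply: (subsetP pC).
    apply: leq_trans card_le _; rewrite -eN.
    rewrite (_ : wr r C S1 rho1 u = set0) ?cards0 //; apply/setP=> v; rewrite in_set0.
    apply/negP=> /wrP[v1 [p [pp lp pC' pr _]]].
    have : N <= size p.
      apply: Np => //; first by move=> a /pC' /(subsetP CA).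
      by rewrite lp; apply/negP=> /(subsetP pCS); rewrite inE v1.
    by rewrite eN ltnNge pr.
  exists N.+1; split; first by rewrite ltn_neqAle ltN.
    rewrite mulSn; apply: leq_trans card_le _; apply: leq_add => //; exact: S1h.
  move=> p; case/lastP: p => [|p v]; first by rewrite /= uC.
  rewrite last_rcons rcons_path size_rcons => /andP[pp lv] pA vC.
  have vA : v \in A by apply: pA; rewrite -rcons_cons mem_rcons mem_head.
  apply: Np => //; first by move=> a ap; apply: pA; rewrite -rcons_cons mem_rcons inE ap orbT.
  by apply: contra vC => lK; apply: ip lv.
- move=> x /glue_component[xCS xp ->].
  by have [_ _ +] := partP x xCS; apply.
Qed.

(** Removing one vertex first, at cost 1, provides proper subsets of [A] with a small cover, from
    which the layering can start. *)
Lemma apex_split : A != set0 ->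
  split r A (1 + r.+1 * h) (fun K => ~ Psi K /\ cov A K 2).
Proof.
case/set0Pn=> v0 v0A.
pose Q K := ~~ (A \subset K) /\ cov A K 2.
apply: (split_bind (Q := Q)).
  apply: (@split_small _ _ _ [set v0]); rewrite ?sub1set ?cards1 // => x xA.
  split.
    apply/subsetPn; exists v0 => //; apply/negP=> /(subsetP (component_sub xA)).
    by rewrite !inE eqxx.
  by apply: covW (cov_component (@connected1 _ v0) _ xA); rewrite ?sub1set.
move=> K KA cK K0 [AK covK].
have [S [rho [SK Sb SP]]] := layered (leqnn #|K|) KA cK K0 AK covK.
exists S, rho; split=> // u uK; have [N [Nr Nw _]] := Sb u uK.
by apply: leq_trans Nw _; rewrite leq_mul2r Nr orbT.
Qed.

End Layers.

(** The vertex [z0] outside the image of [Z] supplies a branch set with [Psi]: the apex is made from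
    it and a connected set that need not have [Psi]. *)
Lemma good_apexS f (Z Zp : sgraph) (i : Z -> Zp) z0 :
  (forall r, 1 < r -> 0 < f r) -> injective i ->
  (forall x y, sedge x y -> sedge (i x) (i y)) -> (forall z, i z != z0) ->
  good f Zp -> good_apex (fun r => r * f r) Z.
Proof.
(* With [s = w * f r], the layers cost at most [2 * r * (2 * c + 6) * s], which gives [4 * c + 12];
   the initial vertex adds one. *)
move=> f0 inj_i hom_i iz0 [c gc]; exists (4 * c + 13) => G T W w r Psi A tdW Ww r1 PsiS cA A0 nmod.
have gZ (Psi' : {set G} -> Prop) A' : upclosed Psi' -> connected_in A' -> A' != set0 ->
    ~ (exists B : Zp -> {set G}, rich_model Psi' A' B) ->
    split r A' (c * w * f r) (fun K => ~ Psi' K /\ cov A' K 2).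
  by move=> h1 h2 h3 h4; apply: (gc G T W w r Psi' A').
apply: splitW (apex_split tdW Ww PsiS cA inj_i hom_i iz0 nmod gZ A0) => //.
have w0 := bag_gt0 tdW Ww A0; have := f0 r r1; move: (f r) => q q0.
have q1 : 0 < w * q by rewrite muln_gt0 w0.
have h1 : 6 * w <= 6 * (w * q) by rewrite leq_mul2l leq_pmulr.
rewrite -!mulnA [w * (r * q)]mulnCA; move: (w * q) h1 q1 => s h1 q1.
have h2 : 2 * (c * s) + 6 * w <= (2 * c + 6) * s by lia.
have h3 : r.+1 <= 2 * r by lia.
apply: leq_trans (leq_add (leqnn 1) (leq_mul h3 h2)) _.
have : 1 <= r * s by rewrite muln_gt0 q1 andbT; lia.
rewrite mulnACA [2 * _]mulnC -[X in 1 + X]mulnA; nia.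
Qed.

(** * Attaching a graph at a vertex *)

Section Attach.
Variables (X Y : sgraph) (a : X).

Definition attach_edge : rel (X + Y)%type := fun u v =>
  match u, v with
  | inl x, inl x' => sedge x x'
  | inr y, inr y' => sedge y y'
  | inl x, inr _ => x == a
  | inr _, inl x => x == a
  end.

Fact attach_edge_sym : symmetric attach_edge.
Proof. by move=> [x|y] [x'|y'] //=; apply: sedge_sym. Qed.

Fact attach_edge_irr : irreflexive attach_edge.
Proof. by move=> [x|y] /=; apply: sedge_irr. Qed.

Definition attach : sgraph := SGraph attach_edge_sym attach_edge_irr.

End Attach.

(** The component of [p] outside the model touches it in [D] or in one branch set, which is itself
    adjacent to [D]. Only that branch set is used up. *)
Lemma apex_reach (G Z : sgraph) (Psi : {set G} -> Prop) (O D : {set G})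
    (B : Z -> {set G}) p : apex_model Psi O D B -> connected_in O -> p \in O ->
  exists (P : {set G}) (zo : option Z), [/\ connected_in P, P \subset O, p \in P, D \subset P &
    forall z, zo <> Some z -> [disjoint P & B z]].
Proof.
move=> [[[B1 B2 B3 B4] BO] [/set0Pn[d dD] cD] DO PD DB] cO pO.
pose M := D :|: \bigcup_z B z.
have MO : M \subset O.
  by rewrite subUset DO; apply/bigcupsP => z _; case: (BO z).
have inM q : q \in M -> exists (P : {set G}) (zo : option Z),
    [/\ connected_in P, P \subset O, q \in P, D \subset P &
      forall z, zo <> Some z -> [disjoint P & B z]].
  case/setUP=> [qD|/bigcupP[z _ qz]].
    by exists D, None; split=> // z _; case: (DB z).
  have [dz az] := DB z; have [zO _] := BO z.
  exists (D :|: B z), (Some z); split.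
  - exact: connectedU_adj.
  - by rewrite subUset DO.
  - by rewrite inE qz orbT.
  - exact: subsetUl.
  move=> z' ne; have zz' : z != z' by apply: contra_not_neq ne => ->.
  rewrite disjoints_subset subUset -!disjoints_subset B3 // andbT.
  by case: (DB z').
have [/inM //|pM] := boolP (p \in M).
have M0 : M != set0 by apply/set0Pn; exists d; rewrite inE dD.
have pOM : p \in O :\: M by rewrite inE pM.
have [x [q [xC qM xq]]] := component_adj cO MO M0 pOM.
have [P [zo [cP PO qP DP dP]]] := inM q qM.
have CO : component (O :\: M) p \subset O :\: M := component_sub pOM.
exists (component (O :\: M) p :|: P), zo; split.
- apply: connectedU_adj => //; first exact: component_connected.
  by exists x, q.
- by rewrite subUset PO andbT; apply: subset_trans CO (subsetDl _ _).
- by rewrite inE mem_component.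
- by apply: subset_trans DP (subsetUr _ _).
move=> z /dP dPz; rewrite disjoints_subset subUset -!disjoints_subset dPz andbT.
rewrite disjoint_sym disjoints_subset; apply/subsetP=> v vz; rewrite inE.
apply/negP=> /(subsetP CO); rewrite inE => /andP[/negP vM _]; apply: vM.
by rewrite inE; apply/orP; right; apply/bigcupP; exists z.
Qed.

Section GoodAttach.
Variables (X Y Z : sgraph) (a : X) (j : nat -> Y -> Z).
Hypothesis inj_j : forall i i' y y', i <= #|X| -> i' <= #|X| ->
  j i y = j i' y' -> i = i' /\ y = y'.
Hypothesis hom_j : forall i y y', i <= #|X| -> sedge y y' -> sedge (j i y) (j i y').

(* Each neighbour of [a] in [X] is reached from the apex through at most one
   copy of [Y], and there are more copies than neighbours. *)
Lemma attach_model (G : sgraph) (Psi : {set G} -> Prop) (A : {set G}) (B0 : X -> {set G}) :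
  upclosed Psi ->
  rich_model (fun H => exists D (B : Z -> {set G}), apex_model Psi H D B) A B0 ->
  exists B : attach Y a -> {set G}, rich_model Psi A B.
Proof.
move=> PsiS [[M1 M2 M3 M4] MA].
have [_ [D [B ap]]] := MA a.
have [[[B1 B2 B3 B4] BO] [D0 cD] DO PD DB] := ap.
pose spec x (p : {set G} * option Z) := sedge a x ->
  [/\ connected_in p.1, p.1 \subset B0 a, D \subset p.1, adj p.1 (B0 x)
    & forall z, p.2 <> Some z -> [disjoint p.1 & B z]].
have /choice[g gP] : forall x, exists p, spec x p.
  move=> x; have [ax|nax] := boolP (sedge a x); last by exists (set0, None) => h; rewrite h in nax.
  have [u [v [uB vB uv]]] := M4 a x ax.
  have [P [zo [cP PO uP DP dP]]] := apex_reach ap (M2 a) uB.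
  by exists (P, zo) => _; split=> //; exists u, v.
have [i iX iP] : exists2 i, i <= #|X| & forall x y, (g x).2 <> Some (j i y).
  apply: contrapT => nex.
  have /choice[h hP] : forall i : 'I_#|X|.+1, exists x, exists y, (g x).2 = Some (j i y).
    move=> i; apply: contrapT => nx; apply: nex; exists (i : nat); first by rewrite -ltnS.
    by move=> x y e; apply: nx; exists x, y.
  have inj_h : injective h.
    move=> i i' e; have [y ey] := hP i; have [y' ey'] := hP i'.
    rewrite e ey' in ey; case: ey => /esym e2.
    by have [e' _] := inj_j (leq_ord i) (leq_ord i') e2; apply: val_inj.
  by have := leq_card h inj_h; rewrite card_ord ltnn.
(* The apex with its connections towards the neighbours of [a] becomes the branch set of [a]; the
   untouched copy [i] models [Y]. *)
pose Ba := D :|: \bigcup_(x | sedge a x) (g x).1.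
have BaO : Ba \subset B0 a.
  by rewrite subUset DO; apply/bigcupsP => x /gP[].
pose B' (u : attach Y a) : {set G} := match u with
  | inl x => if x == a then Ba else B0 x | inr y => B (j i y) end.
have BX x : B' (inl x) \subset B0 x by rewrite /B' /=; case: eqP => [->|].
have BY y : B' (inr y) \subset B0 a by case: (BO (j i y)).
have [d dD] := set0Pn _ D0.
have dBaB y : [disjoint Ba & B (j i y)].
  rewrite disjoints_subset subUset -disjoints_subset; apply/andP; split.
    by case: (DB (j i y)).
  apply/bigcupsP=> x /gP[_ _ _ _ dg]; rewrite -disjoints_subset; apply: dg.
  exact: iP.
have dXY x y : [disjoint B' (inl x) & B' (inr y)].
  rewrite /B' /=; have [_|xa] := eqVneq x a; first exact: dBaB.
  exact: disjointWr (BY y) (M3 _ _ xa).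
have adjXX x x' : sedge x x' -> adj (B' (inl x)) (B' (inl x')).
  have aux x1 : sedge a x1 -> adj Ba (B0 x1).
    move=> ax; have [_ _ _ ag _] := gP x1 ax; apply: adjS ag => //.
    by apply: subset_trans _ (subsetUr _ _); apply: (bigcup_sup _ ax).
  move=> xx; rewrite /B' /=; have [ea|xa] := eqVneq x a; have [ea'|xa'] := eqVneq x' a.
  - by rewrite ea ea' sedge_irr in xx.
  - by apply: aux; rewrite -ea.
  - by apply/adjC/aux; rewrite -ea' sedge_sym.
  - exact: M4.
have adjXY y : adj (B' (inl a)) (B' (inr y)).
  rewrite /B' /= eqxx; have [_ ad] := DB (j i y).
  by apply: adjS ad => //; apply: subsetUl.
exists B'; split; [split|].
- case=> [x|y] /=; last exact: B1.
  by case: (x =P a) => _; [apply/set0Pn; exists d; rewrite inE dD|apply: M1].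
- case=> [x|y] /=; last exact: B2.
  case: eqP => _; last exact: M2.
  apply: (connected_cover cD dD (subsetUl _ _)) => z /setUP[zD|/bigcupP[x' ax' zx']].
    by exists D; split=> //; [apply: subsetUl|exists d].
  have [cg _ Dg _ _] := gP x' ax'; exists (g x').1; split=> //.
    by apply: subset_trans _ (subsetUr _ _); apply: (bigcup_sup _ ax').
  by exists d => //; apply: (subsetP Dg).
- case=> [x|y] [x'|y'] ne.
  + have xx' : x != x' by apply: contra_neq ne => ->.
    exact: disjointWl (BX x) (disjointWr (BX x') (M3 _ _ xx')).
  + exact: dXY.
  + by rewrite disjoint_sym; apply: dXY.
  + apply: B3; apply: contra_neq ne => e.
    by have [_ ->] := inj_j iX iX e.
- case=> [x|y] [x'|y'] e.
  + exact: adjXX.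
  + have -> : x = a by apply/eqP.
    exact: adjXY.
  + have -> : x' = a by apply/eqP.
    by apply/adjC/adjXY.
  + by apply: B4; apply: hom_j.
case=> [x|y]; split.
- by have [xA _] := MA x; apply: subset_trans (BX x) xA.
- rewrite /B' /=; case: eqP => _; first by apply: PsiS PD; apply: subsetUl.
  have [_ [D' [B'' [_ _ D'x PD' _]]]] := MA x.
  exact: PsiS PD'.
- by have [aA _] := MA a; apply: subset_trans (BY y) aA.
- by case: (BO (j i y)).
Qed.

(** The bound for [X] is applied to the property of containing an apex model over [Z], then the
    bound for apexes inside each remaining component. The covers add up to four pieces, and reducing
    these to two costs [4 * w]. *)
Lemma good_attach f : (forall r, 1 < r -> 0 < f r) -> good f X -> good_apex f Z -> good f (attach Y a).
Proof.
move=> f0 [c1 g1] [c2 g2]; exists (c1 + c2 + 4) => G T W w r Psi A tdW Ww r1 PsiS cA A0 nmod.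
pose Psi' (H : {set G}) := exists D (B : Z -> {set G}), apex_model Psi H D B.
have PsiS' : upclosed Psi'.
  move=> H H' HH [D [B [[mB BH] cD DH PD DB]]]; exists D, B; split=> //.
    by split=> // z; have [zH Pz] := BH z; split=> //; apply: subset_trans HH.
  exact: subset_trans HH.
have nX : ~ exists B0 : X -> {set G}, rich_model Psi' A B0.
  by case=> B0 /(attach_model PsiS).
have s1 := g1 G T W w r Psi' A tdW Ww r1 PsiS' cA A0 nX.
have w0 := bag_gt0 tdW Ww A0.
have s2 : split r A (c1 * w * f r + c2 * w * f r) (fun K => ~ Psi K /\ cov A K 4).
  apply: split_bind s1 _ => K KA cK K0 [nP covK].
  apply: splitW (g2 G T W w r Psi K tdW Ww r1 PsiS cK K0 nP) => // K' K'K _ _ [nP' cov'].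
  by split=> //; apply: (cov_trans K'K KA covK cov').
apply: splitW (split_reduce tdW Ww PsiS s2) => //.
by rewrite 4!mulnDl leq_add2l; apply: leq_pmulr; apply: f0.
Qed.

End GoodAttach.

(** * Rooted 2-treedepth *)

Definition hom (X Y : sgraph) (i : X -> Y) : Prop :=
  injective i /\ forall x y, sedge x y -> sedge (i x) (i y).

Definition sgraph1 : sgraph :=
  @SGraph unit (fun _ _ => false) (fun _ _ => erefl) (fun _ => erefl).

(* Up to subgraphs, the graphs of rooted 2-treedepth at most [t]. *)
Inductive tree_like : nat -> sgraph -> Prop :=
| tree_like_edgeless (X : sgraph) : (forall x y : X, ~~ sedge x y) -> tree_like 1 X
| tree_like_one t : tree_like t.+2 sgraph1
| tree_like_attach t (X : sgraph) (a : X) Y :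
    tree_like t.+2 X -> tree_like t.+1 Y -> tree_like t.+2 (attach Y a).

Lemma tree_like1 t : tree_like t.+1 sgraph1.
Proof. by case: t => [|t]; [apply: tree_like_edgeless|apply: tree_like_one]. Qed.

Lemma tree_like1_edgeless X : tree_like 1 X -> forall x y : X, ~~ sedge x y.
Proof.
move E : 1 => n tX; case: tX E => [X' //|t|t X' a Y _ _]; by [].
Qed.

Lemma tree_like_inhab t X : tree_like t.+2 X -> exists x : X, True.
Proof.
move E : t.+2 => n tX; elim: tX t E => [X' _ t [] //|t t' _|t X' a Y _ IH _ _ t' _].
  by exists tt.
by exists (inl a).
Qed.

(** At level one the disjoint union is edgeless. At higher levels the first vertex of [Y] is
    attached to some vertex of [X] and the construction of [Y] is replayed from there; extra edges
    do no harm, as embeddings need not be induced. *)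
Lemma tree_like_join t X Y : tree_like t.+1 X -> tree_like t.+1 Y ->
  exists (Z : sgraph) (i : X -> Z) (j : Y -> Z),
    [/\ tree_like t.+1 Z, hom i, hom j & forall x y, i x != j y].
Proof.
case: t => [|t] tX.
  move=> /tree_like1_edgeless Y0; have X0 := tree_like1_edgeless tX.
  have sy : symmetric (fun _ _ : X + Y => false) by [].
  have ir : irreflexive (fun _ _ : X + Y => false) by [].
  exists (SGraph sy ir), inl, inr; split=> //.
  - exact: tree_like_edgeless.
  - by split=> [x y []|x y] //; rewrite (negPf (X0 x y)).
  - by split=> [x y []|x y] //; rewrite (negPf (Y0 x y)).
move E : t.+2 => n tY; elim: tY t E X tX => {n Y} [Y _ t [] //|t t' [->]|t Y b Y' tY IH tY' _ t' [->]] X tX.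
  have [x _] := tree_like_inhab tX.
  exists (attach sgraph1 x), inl, inr; split.
  - by apply: tree_like_attach tX (tree_like1 _).
  - by split=> [u v []|].
  - by split=> [u v []|].
  - by [].
have [Z [i [j [tZ [ii hi] [ij hj] dij]]]] := IH t erefl X tX.
exists (attach Y' (j b)), (fun x => inl (i x)),
  (fun u : attach Y' b => match u with inl y => inl (j y) | inr y => inr y end); split.
- exact: tree_like_attach.
- by split=> [u v [] /ii|].
- split=> [[u|u] [v|v] //= []|[u|u] [v|v] //= h].
  + by move/ij->.
  + by move->.
  + exact: hj.
  + by rewrite (inj_eq ij).
  + by rewrite (inj_eq ij).
- move=> x [y|y] //; apply: contra_neq (dij x y); by case.
Qed.

Lemma tree_like_copies t Y : tree_like t.+1 Y -> forall k, exists (Z : sgraph) (j : nat -> Y -> Z),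
  [/\ tree_like t.+1 Z,
    forall i i' y y', i <= k -> i' <= k -> j i y = j i' y' -> i = i' /\ y = y'
  & forall i y y', i <= k -> sedge y y' -> sedge (j i y) (j i y')].
Proof.
move=> tY; elim=> [|k [Z [j [tZ jinj jhom]]]].
  by exists Y, (fun=> id); split=> // i i' y y'; rewrite !leqn0 => /eqP-> /eqP->.
have [Z' [f [g [tZ' [fi fh] [gi gh] fg]]]] := tree_like_join tZ tY.
exists Z', (fun i y => if i <= k then f (j i y) else g y); split=> //.
  move=> i i' y y' ik ik'; case: (leqP i k) => h; case: (leqP i' k) => h'.
  - by move/fi; apply: jinj.
  - by move=> e; have := fg (j i y) y'; rewrite e eqxx.
  - by move=> e; have := fg (j i' y') y; rewrite e eqxx.
  move/gi->; split=> //; apply/eqP.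
  by rewrite eqn_leq (leq_trans ik h') (leq_trans ik' h).
move=> i y y' ik yy; case: leqP => h; last exact: gh.
by apply: fh; apply: jhom.
Qed.

Lemma rtd2_decomp (X : sgraph) : 1 < #|X| -> exists A B : subgraph X,
  [/\ is_separation A B, separation_order A B <= 1, #|graph_of A| < #|X|,
      0 < #|graph_of (subgraph_del B (subV A))| < #|X|
    & rtd2 X = maxn (rtd2 (graph_of A))
        (rtd2 (graph_of (subgraph_del B (subV A))) + separation_order A B)].
Proof.
move=> X1; rewrite rtd2E /rtd2_step leqNgt X1 /=.
set P := fun k : nat => _; have exP : exists k, P k.
  have [A [B [s1 s2 s3 s4]]] := separation_exists X1.
  by eexists; exists A, B; split=> //.
have [[A [B [sAB oAB A0 B0 ->]]] _] := minimumP exP.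
exists A, B; split=> //.
  rewrite card_graph_of -cardsT; apply: proper_card; rewrite properT.
  by apply: contra_neq B0 => ->; rewrite setDT.
have /= -> := card_graph_of (subgraph_del B (subV A)).
rewrite card_gt0 B0 /= -cardsT; apply: proper_card; rewrite properT.
by apply: contra_neq A0 => /= e; apply/setP => x;
  have := in_setT x; rewrite -e !inE => /andP[/negbTE].
Qed.

Lemma rtd2_gt0 (X : sgraph) : 0 < #|X| -> 0 < rtd2 X.
Proof.
move: {2}#|X| (leqnn #|X|) => n; elim: n X => [|n IHn] X; first by rewrite leqn0 => /eqP->.
have [X1 _ X0|X1 Xn _] := leqP #|X| 1; first by rewrite rtd2E /rtd2_step X1.
have [A [B [_ _ _ /andP[B0 BX] ->]]] := rtd2_decomp X1.
rewrite leq_max; apply/orP; right; rewrite addn_gt0 IHn //.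
by rewrite -ltnS; apply: leq_trans BX Xn.
Qed.

(** The edges across the two images all come from [B] and start at the shared vertex. An edge of [B]
    with both ends in [A] would be a loop, since at most one vertex is shared. *)
Lemma separation_hom (X Z : sgraph) (A B : subgraph X) (i : graph_of A -> Z)
    (j : graph_of (subgraph_del B (subV A)) -> Z) :
  is_separation A B -> separation_order A B <= 1 -> hom i -> hom j -> (forall u v, i u != j v) ->
  (forall u v, subE B (val u) (val v) -> sedge (i u) (j v)) ->
  exists f : X -> Z, hom f.
Proof.
move=> [cov ed _] o1 [ii hi] [ij hj] dij cross.
pose spec x z := (exists2 u, val u = x & z = i u) \/ (exists2 v, val v = x & z = j v).
have /choice[f fP] : forall x, exists z, spec x z.
  move=> x; have [xA|xA] := boolP (x \in subV A).
    by exists (i (Sub x xA)); left; exists (Sub x xA).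
  have xB : x \in subV B :\: subV A.
    by rewrite inE xA; have := in_setT x; rewrite -cov inE (negPf xA).
  by exists (j (Sub x xB)); right; exists (Sub x xB).
have nA (v : graph_of (subgraph_del B (subV A))) : val v \notin subV A.
  by have := valP v; rewrite inE => /andP[].
exists f; split=> [x y|x y xy].
  case: (fP x) => -[u <- ->]; case: (fP y) => -[v <- ->].
  - by move/ii->.
  - by move=> e; have := dij u v; rewrite e eqxx.
  - by move=> e; have := dij v u; rewrite e eqxx.
  - by move/ij->.
have : subE A x y || subE B x y by rewrite -ed.
case: (fP x) => -[u eu ->]; case: (fP y) => -[v ev ->]; rewrite -eu -ev.
- case/orP=> [uv|/subE_sub/and3P[uB vB _]]; first exact: hi.
  have := card_le1_eqP o1 (val u) (val v); rewrite !inE uB vB (valP u) (valP v).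
  by move=> /(_ isT isT) e; rewrite -eu -ev e sedge_irr in xy.
- by case/orP=> [/subE_sub/and3P[_ + _]|]; [rewrite (negPf (nA v))|apply: cross].
- case/orP=> [/subE_sub/and3P[+ _ _]|]; first by rewrite (negPf (nA u)).
  by rewrite subE_sym sedge_sym; apply: cross.
case/orP=> [/subE_sub/and3P[+ _ _]|uv]; first by rewrite (negPf (nA u)).
by apply: hj; rewrite /= /sub_edge /= /del_edge /= uv !nA.
Qed.

Lemma hom_comp (X Y Z : sgraph) (f : X -> Y) (g : Y -> Z) : hom f -> hom g -> hom (g \o f).
Proof.
move=> [fi fh] [gi gh]; split; first exact: inj_comp.
by move=> x y xy /=; apply/gh/fh.
Qed.

(** A separation of order one becomes an attachment at the image of the shared vertex and uses one
    level; a separation of order zero becomes a join at the same level. *)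
Lemma rtd2_tree_like t (X : sgraph) : rtd2 X <= t.+1 ->
  exists (Y : sgraph) (i : X -> Y), tree_like t.+1 Y /\ hom i.
Proof.
move: {2}#|X| (leqnn #|X|) => n; elim: n X t => [|n IHn] X t Xn rX.
all: have [X1|X1] := leqP #|X| 1.
1,3: exists sgraph1, (fun=> tt); split; first exact: tree_like1.
1,2: have eX (x y : X) : x = y by apply: (card_le1_eqP (A := predT)) => //; rewrite X1.
1,2: by split=> [x y _|x y]; [apply: eX|rewrite (eX x y) sedge_irr].
  by have := leq_trans X1 Xn.
have [A [B [sAB o1 AX /andP[B0 BX] eX]]] := rtd2_decomp X1.
move: rX; rewrite eX geq_max => /andP[rA rB].
have An : #|graph_of A| <= n by rewrite -ltnS; apply: leq_trans AX Xn.
have Bn : #|graph_of (subgraph_del B (subV A))| <= n by rewrite -ltnS; apply: leq_trans BX Xn.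
have [YA [iA [tA hA]]] := IHn _ t An rA.
move: o1 (o1); rewrite {1}leq_eqVlt ltnS leqn0 => /orP[]/eqP o o1; rewrite o in rB.
  rewrite addn1 ltnS in rB.
  (* The nonempty rest of [B] has parameter at least 1, so there is a level to spend. *)
  have := leq_trans (rtd2_gt0 B0) rB; case: t rB tA {rA} => // t rB tA _.
  have [YB [iB [tB hB]]] := IHn _ t Bn rB.
  have /cards1P[x ex] : #|subV A :&: subV B| == 1 by apply/eqP.
  have /setIP[xA xB] : x \in subV A :&: subV B by rewrite ex inE.
  pose a := iA (Sub x xA).
  have [||||f hf] := @separation_hom X (attach YB a) A B (fun u => inl (iA u)) (fun v => inr (iB v)) sAB o1.
  - by split=> [u v []|u v]; [apply: (proj1 hA)|apply: (proj2 hA)].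
  - by split=> [u v []|u v]; [apply: (proj1 hB)|apply: (proj2 hB)].
  - by [].
  - move=> u v /subE_sub/and3P[uB _ _] /=; apply/eqP; congr iA; apply: val_inj => /=.
    by apply/set1P; rewrite -ex inE uB (valP u).
  by exists (attach YB a), f; split=> //; apply: tree_like_attach.
rewrite addn0 in rB; have [YB [iB [tB hB]]] := IHn _ t Bn rB.
have [Z [f [g [tZ hf hg fg]]]] := tree_like_join tA tB.
have [||||h hh] := @separation_hom X Z A B (f \o iA) (g \o iB) sAB o1.
- exact: hom_comp.
- exact: hom_comp.
- by move=> u v; apply: fg.
- move=> u v /subE_sub/and3P[uB _ _].
  have : val u \in subV A :&: subV B by rewrite inE uB (valP u).
  by move/eqP: o; rewrite /separation_order cards_eq0 => /eqP->; rewrite inE.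
by exists Z, h.
Qed.

Lemma good_hom f (X Y : sgraph) (i : X -> Y) : hom i -> good f Y -> good f X.
Proof.
move=> [ii hi] [c gc]; exists c => G T W w r Psi A tdW Ww r1 PsiS cA A0 nX.
apply: (gc G T W w r Psi A) => // -[B [[B1 B2 B3 B4] BA]]; apply: nX.
exists (B \o i); split=> [|x]; last exact: BA.
split=> [x|x|x y xy|x y xy] /=; [exact: B1|exact: B2| |exact/B4/hi].
by apply: B3; rewrite (inj_eq ii).
Qed.

(** * The induction over levels *)

Definition growth t r := r ^ t * lg r.

(** Outer induction on the level, inner induction on the construction of [X]. Attaching [Y] reduces
    to excluding an apex over many copies of [Y], one level lower. At the bottom the copies are
    edgeless; otherwise one more vertex is joined to them and the level below is used, at a factor
    [r]. *)
Lemma good_tree_like t X : tree_like t.+2 X -> good (growth t) X.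
Proof.
have f0 s r : 1 < r -> 0 < growth s r.
  by move=> r1; rewrite muln_gt0 expn_gt0 (ltn_trans _ r1).
elim: t X => [|t IHt] X.
all: move E : _.+2 => n tX; elim: tX E => {n X} [X _ []//|s _|s X a Y tX IHX tY _ [es]].
(* The set [A] itself would model a single vertex, so it does not have [Psi]. *)
1,3: exists 0 => G T W w r Psi A tdW Ww r1 PsiS cA A0 nX; rewrite !mul0n;
  apply: split0 => //; split; [move=> PA; apply: nX; exists (fun=> A); split=> //; split=> //;
    by move=> [] []|exact: cov_self].
all: have [Z [j [tZ jinj jhom]]] := tree_like_copies tY #|X|.
all: apply: (good_attach a jinj jhom (f0 _) (IHX _)); first by rewrite es.
all: subst s.
  suff -> : growth 0 = lg by apply: good_star (tree_like1_edgeless tZ).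
  by apply/funext => r; rewrite /growth mul1n.
have [Zp [i [k [tZp [ii hi] _ ik]]]] := tree_like_join tZ (tree_like1 _).
suff -> : growth t.+1 = (fun r => r * growth t r).
  by apply: (good_apexS (f0 t) ii hi (fun z => ik z tt)); apply: IHt.
by apply/funext => r; rewrite /growth expnS mulnA.
Qed.

(** * From splittings to weak colouring numbers *)

Lemma wcol_split (G : sgraph) r k :
  split r [set: G] k (fun=> False) -> wcol r G <= k.
Proof.
case=> S [rho [_ Sk nS]].
have inS v : v \in S.
  by apply: contrapT => /negP vS; apply: (nS v); rewrite !inE vS.
(* Equal ranks are ordered arbitrarily, which can only remove weakly reachable vertices. *)
pose sigma : rel G := fun x y =>
  (rho x < rho y) || (rho x == rho y) && (enum_rank x <= enum_rank y).
have ord_sigma : is_ordering sigma.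
  split=> [x y|x y|y x z]; rewrite /sigma.
  - by case: ltngtP => //= _; apply: leq_total.
  - case: ltngtP => //= _; rewrite -eqn_leq => /eqP e.
    by apply: enum_rank_inj; apply: val_inj.
  - move=> /orP[xy|/andP[/eqP exy xy]] /orP[yz|/andP[/eqP eyz yz]].
    + by rewrite (ltn_trans xy yz).
    + by rewrite -eyz xy.
    + by rewrite exy yz.
    + by rewrite exy eyz eqxx (leq_trans xy yz) orbT.
have exP : exists n, exists sigma : rel G,
    is_ordering sigma /\ n = \max_(u : G) #|WReach sigma r u|.
  by eexists; exists sigma; split.
apply: leq_trans ((proj2 (minimumP exP)) _ (ex_intro _ sigma (conj ord_sigma erefl))) _.
apply/bigmax_leqP => u _; apply: leq_trans (Sk u (in_setT _)).
apply/subset_leq_card/subsetP=> v; rewrite inE => /asboolP[p [up lp _ sp low]].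
apply/wrP; split=> //; exists p; split=> // [w _|w wp _]; first by rewrite inE.
by have := low w wp; rewrite /sigma; case: ltngtP.
Qed.

Lemma treewidthP (G : sgraph) : exists (T : sgraph) (W : T -> {set G}) w,
  [/\ is_tree_decomposition W, forall t, #|W t| <= w & treewidth G = (w%:Z - 1)%R].
Proof.
have exP : exists k, exists (T : sgraph) (W : T -> {set G}),
    is_tree_decomposition W /\ k = \max_(x : T) #|W x|.
  by have [T [W tdW]] := tree_decomposition_exists G; eexists; exists T, W.
have [[T [W [tdW e]]] _] := minimumP exP.
exists T, W, (\max_(x : T) #|W x|); split=> // [t|].
  exact: (leq_bigmax t).
by rewrite /treewidth -e.
Qed.

Lemma wcol_bound t (X : sgraph) : rtd2 X <= t.+2 -> exists c,
  forall G : sgraph, minor_free G X -> forall r, 1 < r -> exists w : nat,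
    treewidth G = (w%:Z - 1)%R /\ wcol r G <= c * w * growth t r.
Proof.
move=> /rtd2_tree_like[Y [i [tY hi]]].
have [c gc] := good_hom hi (good_tree_like tY).
exists c => G Gfree r r1; have [T [W [w [tdW Ww ew]]]] := treewidthP G.
exists w; split=> //; apply: wcol_split.
have triv : split r [set: G] 0 (fun=> True).
  by apply: (@split_small _ _ _ set0); rewrite ?sub0set ?cards0.
(* The graph may be disconnected, so it is first split into components at no cost. With [Psi] as
   nonemptiness, no component can then be left over. *)
apply: (split_bind (a := 0) triv) => K _ cK K0 _.
pose Psi (H : {set G}) := H != set0.
have PsiS : upclosed Psi.
  by move=> H H' HH /set0Pn[x xH]; apply/set0Pn; exists x; apply: (subsetP HH).
have nK : ~ exists B : X -> {set G}, rich_model Psi K B.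
  by case=> B [mB _]; apply: Gfree; exists B.
have := gc G T W w r Psi K tdW Ww r1 PsiS cK K0 nK.
by apply: splitW => // K' _ _ K'0 [].
Qed.

(** * Passing to the natural logarithm *)

Local Open Scope ring_scope.

Lemma lg_le_ln (R : realType) : exists k : nat, forall r, (1 < r)%N ->
  (lg r)%:R <= k%:R * ln (r%:R : R).
Proof.
have ln2 : 0 < ln (2 : R) by rewrite ln_gt0 // ltr1n.
(* As [trunc_log 2 r] is positive for [r >= 2], [lg r] is at most twice it, and it is at most
   [ln r / ln 2]. *)
exists (Num.bound (2 / ln (2 : R))) => r r1.
set m := trunc_log 2 r.
have m0 : (0 < m)%N by rewrite trunc_log_gt0 //.
have le_ln : m%:R * ln (2 : R) <= ln (r%:R : R).
  rewrite mulr_natl -lnXn // ler_ln ?posrE ?exprn_gt0 ?ltr0n //; last exact: ltn_trans r1.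
  by rewrite -natrX ler_nat trunc_logP // (ltn_trans _ r1).
have lnr0 : 0 <= ln (r%:R : R) by rewrite ln_ge0 // ler1n (ltn_trans _ r1).
have bnd : 2 / ln (2 : R) <= (Num.bound (2 / ln (2 : R)))%:R.
  by apply/ltW/archi_boundP; rewrite divr_ge0 // ltW.
apply: le_trans (ler_wpM2r lnr0 bnd).
have -> : (2 / ln (2 : R)) * ln (r%:R : R) = 2 * (ln r%:R / ln 2).
  by rewrite -mulrA [_^-1 * _]mulrC.
apply: (@le_trans _ _ (2 * m%:R)).
  by rewrite -natrM ler_nat /lg -/m; lia.
by rewrite ler_pM2l // ler_pdivlMr.
Qed.

Theorem theorem6 (R : realType) :
  forall t : nat, (2 <= t)%N ->
  forall X : sgraph, (rtd2 X <= t)%N ->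
  exists c : int,
  forall G : sgraph, minor_free G X ->
  forall r : nat, (2 <= r)%N ->
    (wcol r G)%:R <=
      c%:~R * ((treewidth G)%:~R + 1) * r%:R ^+ (t - 2) * ln (r%:R : R).
Proof.
case=> [//|[//|t]] _ X rX; rewrite -[t.+2]addn2 addnK.
have [c bound] := wcol_bound rX; have [k lgk] := lg_le_ln R.
exists (c * k)%N%:Z => G Gfree r r1.
have [w [-> le_wcol]] := bound G Gfree r r1.
have -> : (w%:Z - 1)%:~R + 1 = w%:R :> R by rewrite rmorphB /= subrK.
have -> : (c * k)%N%:Z%:~R = c%:R * k%:R :> R by rewrite -natrM.
apply: (@le_trans _ _ (c * w * growth t r)%N%:R); first by rewrite ler_nat.
rewrite /growth !natrM natrX.
rewrite mulrA [_ * w%:R]mulrC.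
have -> : c%:R * k%:R * w%:R * r%:R ^+ t * ln (r%:R : R) =
    c%:R * w%:R * r%:R ^+ t * (k%:R * ln r%:R) by rewrite -!mulrA; congr (_ * _); rewrite mulrCA [k%:R * (r%:R ^+ t * _)]mulrCA.
by rewrite [w%:R * _]mulrC; apply: ler_wpM2l (lgk r r1); rewrite !mulr_ge0 ?exprn_ge0.
Qed.
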